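(* Let $n,r\ge1$ be integers. The bigraded Hilbert series of the superspace coinvariant ring $SR_{n,r}$ of $\mathbb{Z}_r\wr\mathfrak{S}_n$ is $$\mathrm{Hilb}(SR_{n,r};q,z)=\sum_{J\subseteq[n]}z^{\#J}\cdot[\mathrm{st}(J,r)_1+1]_q\cdots[\mathrm{st}(J,r)_n+1]_q .$$
   Context: Write $[n]=\{1,\dots,n\}$ and $\zeta=\exp(2\pi i/r)$. $\mathbb{Z}_r\wr\mathfrak{S}_n$ is the group of $n\times n$ complex monomial matrices (exactly one nonzero entry in each row and column) whose nonzero entries are $r$-th roots of unity. $\Omega=\mathbb{C}[x_1,\dots,x_n]\otimes\wedge\{\theta_1,\dots,\theta_n\}$ is the unital associative $\mathbb{C}$-algebra generated by $x_i,\theta_i$ with relations $x_ix_j=x_jx_i$, $x_i\theta_j=\theta_jx_i$, $\theta_i\theta_j=-\theta_j\theta_i$, bigraded with $x_i$ in degree $(1,0)$ and $\theta_i$ in degree $(0,1)$. The group acts on $\Omega$ by algebra automorphisms: $\mathrm{diag}(\zeta^{c_1},\dots,\zeta^{c_n})$ sends $x_i\mapsto\zeta^{-c_i}x_i$, $\theta_i\mapsto\zeta^{-c_i}\theta_i$, and a permutation matrix $w$ sends $x_i\mapsto x_{w(i)}$, $\theta_i\mapsto\theta_{w(i)}$. $SI_{n,r}\subseteq\Omega$ is the two-sided ideal generated by all $(\mathbb{Z}_r\wr\mathfrak{S}_n)$-invariant elements with vanishing constant term, and $SR_{n,r}:=\Omega/SI_{n,r}$, which is bigraded. $\mathrm{Hilb}(SR_{n,r};q,z):=\sum_{i,j\ge0}\dim_{\mathbb{C}}(SR_{n,r})_{i,j}\,q^iz^j$.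 $[m]_q:=1+q+\cdots+q^{m-1}$ for $m\ge0$ (so $[0]_q=0$). For $J\subseteq[n]$, the $(J,r)$-staircase $\mathrm{st}(J,r)=(\mathrm{st}(J,r)_1,\dots,\mathrm{st}(J,r)_n)$ is defined as follows. Write $[n]-J=\{u_1<\cdots<u_k\}$, $u_0:=0$, $u_{k+1}:=n+1$. Set $\mathrm{st}(J,r)_{u_i}:=ir-1$ for $1\le i\le k$; for $j\in J$, set $\mathrm{st}(J,r)_j:=ir-2$, where $1\le i\le k+1$ is the unique index with $u_{i-1}<j<u_i$. *)

(* Defs.v *)
From HB Require Import structures.
From mathcomp Require Import all_boot all_order all_fingroup all_algebra.
From mathcomp Require Import generic_quotient ring_quotient.
From mathcomp Require Import boolp reals.
From mathcomp Require Import complex.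
From mathcomp Require Import mpoly ring zify.

Set Implicit Arguments.
Unset Strict Implicit.
Unset Printing Implicit Defensive.

Import GRing.Theory.
Local Open Scope ring_scope.
Local Open Scope quotient_scope.

(* An element of C[x_1..x_n] (x) /\{theta_1..theta_n} is stored as the family of
   polynomial coefficients f A of the monomials
   theta_A = theta_{a_1} ... theta_{a_k}, where A = {a_1 < ... < a_k}.
   Indices are 0-based: 'I_n stands for [n]. *)
Definition superspace (K : fieldType) (n : nat) : Type :=
  {ffun {set 'I_n} -> {mpoly K[n]}}.

HB.instance Definition _ (K : fieldType) (n : nat) :=
  GRing.Lmodule.on (superspace K n).

Section Superspace.
Variables (K : fieldType) (n : nat).
Local Notation Om := (superspace K n).
Implicit Types (f g h : Om) (A B C : {set 'I_n}) (i j : 'I_n).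

Definition inversions A B : nat := #|[set p in setX A B | (p.2 < p.1)%N]|.

(* theta_A theta_B is the sum over C of theta_coef A B C * theta_C: it vanishes if
   A and B meet, and otherwise it is +/- theta_(A u B), the sign being that of the
   permutation sorting the concatenated word. *)
Definition theta_coef A B C : {mpoly K[n]} :=
  if [disjoint A & B] && (A :|: B == C) then (-1) ^+ inversions A B else 0.

Definition super_mul f g : Om :=
  [ffun C => \sum_A \sum_B theta_coef A B C * (f A * g B)].

Definition super_poly (p : {mpoly K[n]}) : Om :=
  [ffun A => if A == set0 then p else 0].

Definition super_x i : Om := super_poly 'X_i.

Definition super_theta i : Om := [ffun A => if A == [set i] then 1 else 0].

Lemma inversions0l B : inversions set0 B = 0%N.
Proof. by apply: eq_card0 => p; rewrite !inE. Qed.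

Lemma inversions0r A : inversions A set0 = 0%N.
Proof. by apply: eq_card0 => p; rewrite !inE andbF. Qed.

Lemma inversionsUl A B C : [disjoint A & B] ->
  inversions (A :|: B) C = (inversions A C + inversions B C)%N.
Proof.
move=> dAB; rewrite /inversions -cardsUI [X in (_ = _ + X)%N]eq_card0 ?addn0.
  by apply: eq_card => p; rewrite !inE; do !case: (_ \in _) => //=; rewrite ?orbF ?orbb.
move=> p; rewrite !inE; apply/negP => /andP[/andP[/andP[pA _] _]].
by move=> /andP[/andP[pB _] _]; rewrite (disjointFr dAB pA) in pB.
Qed.

Lemma inversionsUr A B C : [disjoint A & B] ->
  inversions C (A :|: B) = (inversions C A + inversions C B)%N.
Proof.
move=> dAB; rewrite /inversions -cardsUI [X in (_ = _ + X)%N]eq_card0 ?addn0.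
  by apply: eq_card => p; rewrite !inE; do !case: (_ \in _) => //=; rewrite ?orbF ?orbb.
move=> p; rewrite !inE; apply/negP => /andP[/andP[/andP[_ pA] _]].
by move=> /andP[/andP[_ pB] _]; rewrite (disjointFr dAB pA) in pB.
Qed.

Lemma sum_theta_coefl A B D C :
  \sum_E theta_coef A B E * theta_coef E D C =
  theta_coef A B (A :|: B) * theta_coef (A :|: B) D C.
Proof.
rewrite (bigD1 (A :|: B)) //= big1 ?addr0 // => E neqE.
by rewrite {1}/theta_coef eq_sym (negPf neqE) andbF mul0r.
Qed.

Lemma sum_theta_coefr A B D C :
  \sum_E theta_coef B D E * theta_coef A E C =
  theta_coef B D (B :|: D) * theta_coef A (B :|: D) C.
Proof.
rewrite (bigD1 (B :|: D)) //= big1 ?addr0 // => E neqE.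
by rewrite {1}/theta_coef eq_sym (negPf neqE) andbF mul0r.
Qed.

Lemma theta_coefA A B D C :
  \sum_E theta_coef A B E * theta_coef E D C =
  \sum_E theta_coef B D E * theta_coef A E C.
Proof.
rewrite sum_theta_coefl sum_theta_coefr /theta_coef !eqxx !andbT setUA.
have dU1 (X Y Z : {set 'I_n}) : [disjoint X :|: Y & Z] = [disjoint X & Z] && [disjoint Y & Z].
  by rewrite -!setI_eq0 setIUl setU_eq0.
rewrite dU1 (disjoint_sym A (B :|: D)) dU1.
rewrite (disjoint_sym B A) (disjoint_sym D A).
case dAB: [disjoint A & B]; case dBD: [disjoint B & D];
  case dAD: [disjoint A & D]; case: eqP => _;
  rewrite /= ?mulr0 ?mul0r //.
by rewrite -!exprD inversionsUl ?dAB // inversionsUr ?dBD // addnA addnC.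
Qed.

Lemma super_mulA : associative super_mul.
Proof.
move=> f g h; apply/ffunP => C; rewrite !ffunE.
transitivity (\sum_A \sum_B \sum_D
    (\sum_E theta_coef B D E * theta_coef A E C) * (f A * g B * h D)).
  apply: eq_bigr => A _.
  under eq_bigr => E _.
    rewrite ffunE !mulr_sumr.
    under eq_bigr => B _ do rewrite !mulr_sumr.
    over.
  rewrite exchange_big; apply: eq_bigr => B _.
  rewrite exchange_big; apply: eq_bigr => D _.
  rewrite mulr_suml; apply: eq_bigr => E _.
  by ring.
under eq_bigr => A _ do under eq_bigr => B _ do under eq_bigr => D _ do
  rewrite -theta_coefA mulr_suml.
under [RHS]eq_bigr => E _ do under eq_bigr => D _ do
  (rewrite ffunE !mulr_suml mulr_sumr;
   under eq_bigr => A _ do rewrite !mulr_suml mulr_sumr).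
symmetry.
under eq_bigr => E _ do rewrite exchange_big /=.
rewrite exchange_big; apply: eq_bigr => A _.
under eq_bigr => E _ do rewrite exchange_big /=.
rewrite exchange_big; apply: eq_bigr => B _.
rewrite exchange_big; apply: eq_bigr => D _.
by apply: eq_bigr => E _; ring.
Qed.

Lemma super_polyMl p f C : super_mul (super_poly p) f C = p * f C.
Proof.
rewrite ffunE (bigD1 set0) //= [X in _ + X]big1 ?addr0; last first.
  by move=> A nzA; apply: big1 => B _; rewrite ffunE (negPf nzA) mul0r mulr0.
rewrite (bigD1 C) //= big1 ?addr0 => [|B neB]; rewrite ffunE eqxx /theta_coef set0U.
  by rewrite eqxx disjoints_subset sub0set inversions0l expr0 mul1r.
by rewrite (negPf neB) andbF mul0r.
Qed.

Lemma super_polyMr p f C : super_mul f (super_poly p) C = f C * p.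
Proof.
rewrite ffunE exchange_big (bigD1 set0) //= [X in _ + X]big1 ?addr0; last first.
  by move=> A nzA; apply: big1 => B _; rewrite ffunE (negPf nzA) !mulr0.
rewrite (bigD1 C) //= big1 ?addr0 => [|B neB]; rewrite ffunE eqxx /theta_coef setU0.
  by rewrite eqxx disjoint_sym disjoints_subset sub0set inversions0r expr0 mul1r.
by rewrite (negPf neB) andbF mul0r.
Qed.

Lemma super_mul1l : left_id (super_poly 1) super_mul.
Proof. by move=> f; apply/ffunP => C; rewrite super_polyMl mul1r. Qed.

Lemma super_mul1r : right_id (super_poly 1) super_mul.
Proof. by move=> f; apply/ffunP => C; rewrite super_polyMr mulr1. Qed.

Lemma super_mulDl : left_distributive super_mul +%R.
Proof.
move=> f g h; apply/ffunP => C; rewrite !ffunE -big_split; apply: eq_bigr => A _.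
by rewrite -big_split; apply: eq_bigr => B _; rewrite /= ffunE mulrDl mulrDr.
Qed.

Lemma super_mulDr : right_distributive super_mul +%R.
Proof.
move=> f g h; apply/ffunP => C; rewrite !ffunE -big_split; apply: eq_bigr => A _.
by rewrite -big_split; apply: eq_bigr => B _; rewrite /= ffunE !mulrDr.
Qed.

Lemma super_poly1_neq0 : super_poly 1 != 0.
Proof. by apply/eqP => /ffunP/(_ set0)/eqP; rewrite !ffunE eqxx oner_eq0. Qed.

HB.instance Definition _ := GRing.Zmodule_isNzRing.Build Om
  super_mulA super_mul1l super_mul1r super_mulDl super_mulDr super_poly1_neq0.

Lemma super_scaleAl (c : K) f g : c *: (f * g) = (c *: f) * g.
Proof.
apply/ffunP => C; rewrite !ffunE scaler_sumr; apply: eq_bigr => A _.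
by rewrite scaler_sumr; apply: eq_bigr => B _; rewrite ffunE -scalerAl scalerAr.
Qed.

HB.instance Definition _ := GRing.Lmodule_isLalgebra.Build K Om super_scaleAl.

Lemma super_scaleAr (c : K) f g : c *: (f * g) = f * (c *: g).
Proof.
apply/ffunP => C; rewrite !ffunE scaler_sumr; apply: eq_bigr => A _.
by rewrite scaler_sumr; apply: eq_bigr => B _; rewrite ffunE -!scalerAr.
Qed.

HB.instance Definition _ := GRing.Lalgebra_isAlgebra.Build K Om super_scaleAr.

End Superspace.

Section GeneratorsAndRelations.
Variables (K : fieldType) (n : nat).
Local Notation Om := (superspace K n).
Implicit Types (f : Om) (A B : {set 'I_n}) (i j : 'I_n).

Definition super_thetas A : Om := [ffun B => if B == A then 1 else 0].

Lemma super_thetas0 : super_thetas set0 = 1.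
Proof. by []. Qed.

Lemma super_thetasM A B : [disjoint A & B] ->
  super_thetas A * super_thetas B =
  (-1) ^+ inversions A B *: super_thetas (A :|: B).
Proof.
move=> dAB; apply/ffunP => C; rewrite !ffunE (bigD1 A) //= [X in _ + X]big1 ?addr0.
  rewrite (bigD1 B) //= [X in _ + X]big1 ?addr0 => [|D neD].
    rewrite !ffunE !eqxx !mulr1 /theta_coef dAB /= eq_sym.
    case: eqP => _; rewrite ?scaler0 // -signr_odd -[in RHS]signr_odd.
    by case: odd; rewrite ?expr1 ?expr0 ?scaleN1r ?scale1r.
  by rewrite !ffunE (negPf neD) !mulr0.
by move=> D neD; apply: big1 => E _; rewrite ffunE (negPf neD) mul0r mulr0.
Qed.

Lemma prod_super_theta A : \prod_(i <- enum A) super_theta K i = super_thetas A.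
Proof.
have: sorted (fun i j : 'I_n => i < j)%N (enum A).
  rewrite {1}/enum_mem -enumT; apply: sorted_filter.
    by move=> ? ? ?; apply: ltn_trans.
  rewrite -[sorted _ _]/(sorted (relpre val ltn) (enum 'I_n)) -sorted_map.
  by rewrite val_enum_ord iota_ltn_sorted.
rewrite -[in RHS](set_enum A); elim: (enum A) => [_|i s IHs].
  by rewrite big_nil -super_thetas0; congr super_thetas; apply/setP=> i; rewrite !inE.
rewrite [sorted _ _]/= (path_sortedE (fun _ _ _ => @ltn_trans _ _ _)).
case/andP => /allP lt_is s_s.
rewrite big_cons IHs // -/(super_thetas [set i]) super_thetasM; last first.
  by rewrite disjoints1 inE; apply/negP => /lt_is; rewrite ltnn.
have ->: inversions [set i] [set j in s] = 0%N.
  apply: eq_card0 => p; rewrite !inE.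
  by apply/negP => /andP[/andP[/eqP-> /lt_is lt_i]]; rewrite ltnNge ltnW.
by rewrite expr0 scale1r; congr super_thetas; apply/setP => j; rewrite !inE.
Qed.

Lemma super_decomp f : f = \sum_A super_poly (f A) * \prod_(i <- enum A) super_theta K i.
Proof.
apply/ffunP => C; rewrite sum_ffunE (bigD1 C) //= [X in _ + X]big1 ?addr0 => [|A neA].
  by rewrite [RHS]super_polyMl prod_super_theta ffunE eqxx mulr1.
by rewrite [LHS]super_polyMl prod_super_theta ffunE eq_sym (negPf neA) mulr0.
Qed.

Lemma super_xC i j : super_x K i * super_x K j = super_x K j * super_x K i.
Proof. by apply/ffunP => C; rewrite [LHS]super_polyMl [RHS]super_polyMr mulrC. Qed.

Lemma super_x_theta i j : super_x K i * super_theta K j = super_theta K j * super_x K i.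
Proof. by apply/ffunP => C; rewrite [LHS]super_polyMl [RHS]super_polyMr mulrC. Qed.

Lemma super_thetaN i j :
  super_theta K i * super_theta K j = - (super_theta K j * super_theta K i).
Proof.
have theta2 k : super_theta K k * super_theta K k = 0.
  apply/ffunP => C; rewrite !ffunE big1 // => A _; apply: big1 => B _.
  rewrite !ffunE; case: eqP => [->|]; case: eqP => [->|];
    rewrite ?(mul0r, mulr0) // /theta_coef.
  by rewrite disjoints1 inE eqxx mul0r.
have [->|neij] := eqVneq i j; first by rewrite theta2 oppr0.
have inv1 k l : inversions [set k] [set l] = (l < k)%N.
  rewrite /inversions -[RHS]muln1 -(cards1 (k, l)).
  case: ltnP => [lt_lk|le_kl]; rewrite ?mul1n ?mul0n.
    apply: eq_card => -[a b]; rewrite !inE /= xpair_eqE.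
    by case: eqP => // ->; case: eqP => // ->; rewrite lt_lk.
  apply: eq_card0 => -[a b]; rewrite !inE /=; apply/negP.
  by case/andP => /andP[/eqP-> /eqP->]; rewrite ltnNge le_kl.
rewrite -[super_theta K i]/(super_thetas [set i]).
rewrite -[super_theta K j]/(super_thetas [set j]).
have dij : [disjoint [set i] & [set j]] by rewrite disjoints1 inE.
rewrite (super_thetasM dij) super_thetasM 1?disjoint_sym // !inv1.
rewrite [[set j] :|: _]setUC -scaleNr.
have := neij; rewrite neq_ltn; case: ltngtP => //= _ _.
by rewrite expr0 expr1 opprK.
Qed.

End GeneratorsAndRelations.

Section Action.
Variables (K : fieldType) (n : nat).
Local Notation Om := (superspace K n).
Implicit Types (f : Om) (g : 'M[K]_n).

Definition in_wreath (r : nat) g : Prop :=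
  [/\ forall i, exists! j, g i j != 0,
      forall j, exists! i, g i j != 0 &
      forall i j, g i j != 0 -> g i j ^+ r = 1].

(* A matrix acts on the coordinate functions x_i (and likewise on theta_i)
   contragrediently: g sends x_i to \sum_j (g^-1)_ij x_j. See super_act_diag and
   super_act_perm for diagonal and permutation matrices. *)
Definition act_x g : n.-tuple {mpoly K[n]} :=
  [tuple \sum_j invmx g i j *: 'X_j | i < n].

Definition act_theta g (i : 'I_n) : Om := \sum_j invmx g i j *: super_theta K j.

(* The algebra map extending act_x and act_theta, computed on the expansion
   super_decomp; enum A lists A increasingly. *)
Definition super_act g f : Om :=
  \sum_(A : {set 'I_n})
    super_poly (f A \mPo act_x g) * \prod_(i <- enum A) act_theta g i.

Lemma super_act_x g i : super_act g (super_x K i) = super_poly (tnth (act_x g) i).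
Proof.
rewrite /super_act (bigD1 set0) //= [X in _ + X]big1 ?addr0 => [|A nzA].
  by rewrite ffunE eqxx comp_mpolyXU -tnth_nth enum_set0 big_nil mulr1.
rewrite ffunE (negPf nzA) comp_mpoly0.
by apply/ffunP => C; rewrite [LHS]super_polyMl mul0r ffunE.
Qed.

Lemma super_act_theta g i : super_act g (super_theta K i) = act_theta g i.
Proof.
rewrite /super_act (bigD1 [set i]) //= [X in _ + X]big1 ?addr0 => [|A neA].
  by rewrite ffunE eqxx comp_mpoly1 enum_set1 big_seq1 mul1r.
rewrite ffunE (negPf neA) comp_mpoly0.
by apply/ffunP => C; rewrite [LHS]super_polyMl mul0r ffunE.
Qed.

Lemma super_act_diag (d : 'rV[K]_n) i : (forall j, d 0 j != 0) ->
  super_act (diag_mx d) (super_x K i) = (d 0 i)^-1 *: super_x K i /\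
  super_act (diag_mx d) (super_theta K i) = (d 0 i)^-1 *: super_theta K i.
Proof.
move=> nz_d; pose e := \row_j (d 0 j)^-1.
have inv_d : invmx (diag_mx d) = diag_mx e.
  have de1 : diag_mx e *m diag_mx d = 1%:M.
    rewrite mulmx_diag; apply/matrixP => j k; rewrite !mxE.
    by rewrite mulVf.
  have [_ ud] := mulmx1_unit de1.
  by rewrite -[LHS]mul1mx -de1 mulmxK.
have dE j : diag_mx e i j = (d 0 i)^-1 *+ (i == j) by rewrite !mxE.
split.
  rewrite super_act_x tnth_mktuple inv_d (bigD1 i) //= big1 ?addr0 => [|j neij].
    rewrite dE eqxx; apply/ffunP => C; rewrite !ffunE.
    by case: eqP; rewrite ?scaler0.
  by rewrite dE eq_sym (negPf neij) scale0r.
rewrite super_act_theta /act_theta inv_d (bigD1 i) //= big1 ?addr0 => [|j neij].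
  by rewrite dE eqxx.
by rewrite dE eq_sym (negPf neij) scale0r.
Qed.

(* perm_mx w has its 1's at (i, w i); the matrix mapping the column e_i to
   e_(w i) is its transpose. *)
Lemma super_act_perm (w : 'S_n) i :
  super_act (perm_mx w)^T (super_x K i) = super_x K (w i) /\
  super_act (perm_mx w)^T (super_theta K i) = super_theta K (w i).
Proof.
have inv_w : invmx (perm_mx w)^T = perm_mx w :> 'M[K]_n.
  have ww1 : perm_mx w *m (perm_mx w)^T = 1%:M :> 'M[K]_n.
    by rewrite tr_perm_mx -perm_mxM mulgV perm_mx1.
  have [_ uw] := mulmx1_unit ww1.
  by rewrite -[LHS]mul1mx -ww1 mulmxK.
have wE j : perm_mx w i j = (w i == j)%:R :> K by rewrite !mxE.
split.
  rewrite super_act_x tnth_mktuple inv_w (bigD1 (w i)) //= big1 ?addr0 => [|j neij].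
    by rewrite wE eqxx scale1r.
  by rewrite wE eq_sym (negPf neij) scale0r.
rewrite super_act_theta /act_theta inv_w (bigD1 (w i)) //= big1 ?addr0 => [|j neij].
  by rewrite wE eqxx scale1r.
by rewrite wE eq_sym (negPf neij) scale0r.
Qed.

Definition super_invariant (r : nat) f : Prop :=
  forall g, in_wreath r g -> super_act g f = f.

Definition constant_term f : K := (f set0)@_0%MM.

Definition bihomogeneous (i j : nat) f : Prop :=
  forall A, (f A \is i.-homog) /\ (#|A| != j -> f A = 0).

End Action.

Section TwoSidedQuotient.
Variables (K : fieldType) (A : algType K) (S : A -> Prop).

Definition gen_ideal : {pred A} := fun f =>
  `[< exists (m : nat) (a s b : 'I_m -> A),
        (forall k, S (s k)) /\ f = \sum_k a k * s k * b k >].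

Lemma gen_idealMl c f : f \in gen_ideal -> c * f \in gen_ideal.
Proof.
move=> /asboolP[m [a [s [b [Ss ->]]]]]; apply/asboolP.
exists m, (fun k => c * a k), s, b; split=> //.
by rewrite mulr_sumr; apply: eq_bigr => k _; rewrite !mulrA.
Qed.

Lemma gen_idealMr c f : f \in gen_ideal -> f * c \in gen_ideal.
Proof.
move=> /asboolP[m [a [s [b [Ss ->]]]]]; apply/asboolP.
exists m, a, s, (fun k => b k * c); split=> //.
by rewrite mulr_suml; apply: eq_bigr => k _; rewrite !mulrA.
Qed.

Lemma gen_ideal_zmod_closed : zmod_closed gen_ideal.
Proof.
split=> [|f1 f2 If1 If2].
  apply/asboolP; exists 0%N, (fun=> 0), (fun=> 0), (fun=> 0).
  by split=> [[]|] //; rewrite big_ord0.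
have /asboolP[m2 [a2 [s2 [b2 [Ss2 f2E]]]]] : - f2 \in gen_ideal.
  by rewrite -mulN1r gen_idealMl.
move: If1 => /asboolP[m1 [a1 [s1 [b1 [Ss1 ->]]]]]; rewrite f2E; apply/asboolP.
pose glue (u : 'I_m1 -> A) (v : 'I_m2 -> A) k :=
  match split k with inl k1 => u k1 | inr k2 => v k2 end.
have glueL u v k : glue u v (lshift m2 k) = u k.
  by rewrite /glue; case: split_ordP => k' /eqP; rewrite ?eq_lshift ?eq_lrshift // => /eqP->.
have glueR u v k : glue u v (rshift m1 k) = v k.
  by rewrite /glue; case: split_ordP => k' /eqP; rewrite ?eq_rshift ?eq_rlshift // => /eqP->.
exists (m1 + m2)%N, (glue a1 a2), (glue s1 s2), (glue b1 b2); split.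
  by move=> k; rewrite /glue; case: split.
by rewrite big_split_ord; congr (_ + _); apply: eq_bigr => k _; rewrite ?(glueL, glueR).
Qed.

HB.instance Definition _ :=
  GRing.isZmodClosed.Build A gen_ideal gen_ideal_zmod_closed.

Definition quot_alg : Type := {ideal_quot gen_ideal}.

HB.instance Definition _ := GRing.Zmodule.on quot_alg.
HB.instance Definition _ := EqQuotient.on quot_alg.

Definition quot_pi (f : A) : quot_alg := \pi f.

Lemma quot_pi_eq f1 f2 : quot_pi f1 = quot_pi f2 <-> f1 - f2 \in gen_ideal.
Proof. by rewrite Quotient.idealrBE; split=> /eqP. Qed.

Lemma quot_piD f1 f2 : quot_pi (f1 + f2) = quot_pi f1 + quot_pi f2.
Proof. exact: (raddfD \pi_({ideal_quot gen_ideal})). Qed.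

Lemma quot_reprK (u : quot_alg) : quot_pi (repr u) = u.
Proof. exact: reprK. Qed.

Definition quot_one : quot_alg := quot_pi 1.
Definition quot_mul (u v : quot_alg) : quot_alg := quot_pi (repr u * repr v).
Definition quot_scale (c : K) (u : quot_alg) : quot_alg := quot_pi (c *: repr u).

Lemma quot_piM f1 f2 : quot_pi (f1 * f2) = quot_mul (quot_pi f1) (quot_pi f2).
Proof.
apply/quot_pi_eq; set g1 := repr _; set g2 := repr _.
have ->: f1 * f2 - g1 * g2 = (f1 - g1) * f2 + g1 * (f2 - g2).
  by rewrite mulrBl mulrBr addrA subrK.
by apply: rpredD; [apply: gen_idealMr|apply: gen_idealMl];
  apply/quot_pi_eq; rewrite quot_reprK.
Qed.

Lemma quot_piZ c f : quot_pi (c *: f) = quot_scale c (quot_pi f).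
Proof.
apply/quot_pi_eq; rewrite -scalerBr -mulr_algl; apply: gen_idealMl.
by apply/quot_pi_eq; rewrite quot_reprK.
Qed.

Lemma quot_mulA : associative quot_mul.
Proof.
by move=> u v w; rewrite -[u]quot_reprK -[v]quot_reprK -[w]quot_reprK -!quot_piM mulrA.
Qed.

Lemma quot_mul1l : left_id quot_one quot_mul.
Proof. by move=> u; rewrite -[u]quot_reprK -quot_piM mul1r. Qed.

Lemma quot_mul1r : right_id quot_one quot_mul.
Proof. by move=> u; rewrite -[u]quot_reprK -quot_piM mulr1. Qed.

Lemma quot_mulDl : left_distributive quot_mul +%R.
Proof.
move=> u v w; rewrite -[u]quot_reprK -[v]quot_reprK -[w]quot_reprK.
by rewrite -quot_piD -!quot_piM -quot_piD mulrDl.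
Qed.

Lemma quot_mulDr : right_distributive quot_mul +%R.
Proof.
move=> u v w; rewrite -[u]quot_reprK -[v]quot_reprK -[w]quot_reprK.
by rewrite -quot_piD -!quot_piM -quot_piD mulrDr.
Qed.

HB.instance Definition _ := GRing.Zmodule_isPzRing.Build quot_alg
  quot_mulA quot_mul1l quot_mul1r quot_mulDl quot_mulDr.

Lemma quot_scaleA c d u : quot_scale c (quot_scale d u) = quot_scale (c * d) u.
Proof. by rewrite -[u]quot_reprK -!quot_piZ scalerA. Qed.

Lemma quot_scale1 : left_id 1 quot_scale.
Proof. by move=> u; rewrite -[u]quot_reprK -quot_piZ scale1r. Qed.

Lemma quot_scaleDr : right_distributive quot_scale +%R.
Proof.
move=> c u v; rewrite -[u]quot_reprK -[v]quot_reprK.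
by rewrite -quot_piD -!quot_piZ -quot_piD scalerDr.
Qed.

Lemma quot_scaleDl u c d : quot_scale (c + d) u = quot_scale c u + quot_scale d u.
Proof. by rewrite -[u]quot_reprK -!quot_piZ -quot_piD scalerDl. Qed.

HB.instance Definition _ := GRing.Zmodule_isLmodule.Build K quot_alg
  quot_scaleA quot_scale1 quot_scaleDr quot_scaleDl.

End TwoSidedQuotient.

(* The subspace W of V is finite-dimensional, of dimension d. *)
Definition has_dim (K : fieldType) (V : lmodType K) (W : V -> Prop) (d : nat) : Prop :=
  exists b : 'I_d -> V,
    [/\ forall k, W (b k),
        forall c : 'I_d -> K, \sum_k c k *: b k = 0 -> forall k, c k = 0 &
        forall v, W v -> exists c : 'I_d -> K, v = \sum_k c k *: b k].

Section CoinvariantRing.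
Variables (K : fieldType) (n r : nat).

Definition positive_invariant (f : superspace K n) : Prop :=
  super_invariant r f /\ constant_term f = 0.

(* Omega / SI, where SI = gen_ideal positive_invariant. *)
Definition SR : Type := quot_alg positive_invariant.

HB.instance Definition _ := GRing.PzRing.on SR.
HB.instance Definition _ := GRing.Lmodule.on SR.

Definition SR_component (i j : nat) (u : SR) : Prop :=
  exists2 f, bihomogeneous i j f & u = quot_pi positive_invariant f.

(* Hilb(SR; q, z) = H, as an identity of formal power series. The outer variable
   of H is z and the inner one is q, so that H`_j`_i is the coefficient of
   q^i z^j. *)
Definition SR_Hilb_is (H : {poly {poly nat}}) : Prop :=
  forall i j : nat, has_dim (SR_component i j) (H`_j`_i)%R.

End CoinvariantRing.

Section Staircase.
Variables (n r : nat) (J : {set 'I_n}).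

(* The increasing enumeration u_1 < ... < u_k of the complement of J. *)
Definition free_seq : seq 'I_n := enum (~: J).

(* For j in J the index i with u_(i-1) < j < u_i is the first one with j < u_i,
   and it is k + 1 when there is none. The value -1 occurs when r = 1 and j
   lies below u_1. *)
Definition staircase (j : 'I_n) : int :=
  if j \in J then ((find (fun u : 'I_n => (j < u)%N) free_seq).+1 * r)%:Z - 2
  else ((index j free_seq).+1 * r)%:Z - 1.

Lemma staircase_ge (j : 'I_n) : (0 < r)%N -> -1 <= staircase j.
Proof. by rewrite /staircase; case: r => // r' _; case: ifP; rewrite mulSn; lia. Qed.

End Staircase.

Definition qnum (m : nat) : {poly nat} := \sum_(k < m) 'X^k.

(* The absolute value is that of a nonnegative integer, by staircase_ge. *)
Definition staircase_sum (n r : nat) : {poly {poly nat}} :=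
  \sum_(J : {set 'I_n})
    'X^#|J| * (\prod_(j < n) qnum `|(staircase r J j + 1)%R|%N)%:P.

(* Main.v *)
Require Import Defs.
From mathcomp Require Import all_boot all_order all_fingroup all_algebra.
From mathcomp Require Import cyclic separable cyclotomic.
From mathcomp Require Import boolp reals.
From mathcomp Require Import complex.
From mathcomp Require Import mpoly ring zify.

(* Write y_a = x_a^r and S = C[x_1,...,x_n], and let I be the ideal of S generated
   by the power sums of the y_a. By polarization, SI is generated by the power
   sums and the elements \sum_a x_a^(rk-1) theta_a.

   For J a set of indices, put f_J = \prod_(j in J) x_j \prod_(u > j) (y_j - y_u),
   with the colon ideal (I : f_J), and for j in J put
   g_j = x_j^(r-1) \prod_(u < j, u notin J) (y_j - y_u), of degree st(J, r)_j + 1.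
   The derivations x_i |-> x_i \prod_(u > j) (y_i - y_u) preserve I. Contracting with
   those indexed by J maps SI into I, kills theta_K when K has at least the weight
   (sum of indices) of J and K <> J, and maps theta_J to f_J up to sign; so
   p theta_J is independent of the theta_K of larger weight modulo SI when
   p is not in (I : f_J). Conversely g_j theta_J lies in SI up to terms of larger
   weight. Hence it suffices that I + (g_j)_j and (I : f_J) coincide, with quotient
   of Hilbert series H_J = \prod_i [st(J, r)_i + 1].

   Filtering by linear factors shows that the quotient by I + (g_j)_j, and similar
   ones, have at most the expected Hilbert series. For J empty this is an equality,
   by graded Nakayama. Removing the maximum j of J, the bounds for
   (I : f_(J - j)) + (f_{j}) and for (I : f_J), the latter shifted by the degree of
   f_{j}, add up to H_(J - j), so both must be equalities. *)

Set Implicit Arguments.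
Unset Strict Implicit.
Unset Printing Implicit Defensive.

Import GRing.Theory.
Local Open Scope ring_scope.

(** * Spanning families modulo homogeneous ideals *)

Section Span.
Variables (K : fieldType) (V : lmodType K).

(** If [N < M], a nonzero row killing [A] on the left is a nontrivial relation among the [v k]. *)
Lemma free_leq_span M N (v : 'I_M -> V) (w : 'I_N -> V) (A : 'M[K]_(M, N)) :
    (forall k, v k = \sum_l A k l *: w l) ->
    (forall c : 'I_M -> K, \sum_k c k *: v k = 0 -> forall k, c k = 0) ->
  (M <= N)%N.
Proof.
move=> vE v_free; rewrite leqNgt; apply/negP => ltNM.
have : kermx A != 0.
  by rewrite -mxrank_eq0 mxrank_ker -lt0n subn_gt0 (leq_ltn_trans (rank_leq_col A)).
case/rowV0Pn => u /sub_kermxP uA0 /eqP; case; apply/rowP => k.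
rewrite mxE; apply: (v_free (fun k => u 0 k)).
under eq_bigr => j _ do rewrite vE scaler_sumr.
rewrite exchange_big big1 // => l _.
under eq_bigr => j _ do rewrite scalerA.
rewrite -scaler_suml.
by have /rowP/(_ l) := uA0; rewrite !mxE => ->; rewrite scale0r.
Qed.

End Span.

Section Ideals.
Variables (K : fieldType) (n : nat).
Local Notation S := {mpoly K[n]}.
Local Notation hcomp := (pihomog [measure of mdeg]).
Implicit Types (E F : S -> Prop) (a p q : S) (d m N : nat) (P Q : {poly nat}).

Lemma hcompM m d a q : a \is m.-homog ->
  hcomp d (a * q) = if (m <= d)%N then a * hcomp (d - m) q else 0.
Proof.
(* The bound [k] exceeds [d] as well as the degree of [q], so the index [d - m] occurs in the sum
   even when that component of [q] is zero. *)
move=> ha; pose k := maxn (mmeasure [measure of mdeg] q) d.+1.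
rewrite {1}(@pihomog_partitionE _ _ [measure of mdeg] k q) ?leq_maxl //.
rewrite mulr_sumr raddf_sum /=.
have homk e : a * hcomp e q \is (m + e).-homog by apply: dhomogM ha (pihomogP _ _ _).
case: leqP => [le_md|lt_dm]; last first.
  apply: big1 => e _; apply: (pihomog_ne0 _ (homk e)).
  by rewrite neq_ltn orbC (leq_trans lt_dm) ?leq_addr.
have ltk : (d - m < k)%N by rewrite /k; lia.
rewrite (bigD1 (Ordinal ltk)) //= big1 ?addr0 => [|e neq].
  by rewrite pihomog_dE // -{2}(subnKC le_md).
apply: (pihomog_ne0 _ (homk e)); apply: contraNneq neq => /esym eq_d.
by apply/eqP/val_inj => /=; rewrite eq_d addKn.
Qed.

Record hideal E : Prop := HIdeal {
  hideal0 : E 0;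
  hidealD p q : E p -> E q -> E (p + q);
  hidealM q p : E p -> E (q * p);
  hideal_comp d p : E p -> E (hcomp d p) }.

(** The ideals $E + (a)$ and $(E : a)$, and $E + (s)$ for a list [s] of generators. *)
Definition iadd E a : S -> Prop := fun p => exists e q, E e /\ p = e + a * q.
Definition icolon E a : S -> Prop := fun q => E (a * q).
Definition iadds E (s : seq S) := foldl iadd E s.

Section HIdealTheory.
Variables (E : S -> Prop) (hE : hideal E).

Lemma hidealMr q p : E p -> E (p * q).
Proof. by rewrite mulrC; apply: hidealM. Qed.

Lemma hidealZ (c : K) p : E p -> E (c *: p).
Proof. by rewrite -mul_mpolyC; apply: hidealM. Qed.

Lemma hidealN p : E p -> E (- p).
Proof. by rewrite -scaleN1r; apply: hidealZ. Qed.

Lemma hidealB p q : E p -> E q -> E (p - q).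
Proof. by move=> Ep Eq; apply: hidealD => //; apply: hidealN. Qed.

Lemma hideal_sum I (r : seq I) (Q : pred I) (f : I -> S) :
  (forall i, Q i -> E (f i)) -> E (\sum_(i <- r | Q i) f i).
Proof. by move=> Ef; elim/big_ind: _; [apply: hideal0|apply: hidealD|]. Qed.

Lemma hideal_eqmod p q : E (p - q) -> E q -> E p.
Proof. by move=> Epq Eq; rewrite -(subrK q p); apply: hidealD. Qed.

Lemma hideal_iadd m a : a \is m.-homog -> hideal (iadd E a).
Proof.
move=> ha; split.
- by exists 0, 0; rewrite mulr0 addr0; split=> //; apply: hideal0.
- move=> _ _ [e1 [q1 [Ee1 ->]]] [e2 [q2 [Ee2 ->]]]; exists (e1 + e2), (q1 + q2).
  by split; [apply: hidealD|ring].
- move=> q _ [e1 [q1 [Ee1 ->]]]; exists (q * e1), (q * q1).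
  by split; [apply: hidealM|ring].
- move=> d _ [e1 [q1 [Ee1 ->]]].
  exists (hcomp d e1), (if (m <= d)%N then hcomp (d - m) q1 else 0).
  split; first exact: hideal_comp.
  by rewrite raddfD /= (hcompM _ _ ha); case: ifP; rewrite ?mulr0.
Qed.

Lemma hideal_icolon m a : a \is m.-homog -> hideal (icolon E a).
Proof.
move=> ha; split; rewrite /icolon.
- by rewrite mulr0; apply: hideal0.
- by move=> p q Ep Eq; rewrite mulrDr; apply: hidealD.
- by move=> q p Ep; rewrite mulrCA; apply: hidealM.
- move=> d p /(hideal_comp hE (m + d)); rewrite (hcompM _ _ ha) leq_addr.
  by rewrite addKn.
Qed.

Lemma iaddW a p : E p -> iadd E a p.
Proof. by move=> Ep; exists p, 0; rewrite mulr0 addr0. Qed.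

Lemma iadd_gen a : iadd E a a.
Proof. by exists 0, 1; rewrite mulr1 add0r; split=> //; apply: hideal0. Qed.

Lemma icolonW a p : E p -> icolon E a p.
Proof. exact: hidealM. Qed.

End HIdealTheory.

Lemma iadd_mono E F a p : (forall q, E q -> F q) -> iadd E a p -> iadd F a p.
Proof. by move=> EF [e [q [Ee ->]]]; exists e, q; split; first exact: EF. Qed.

Lemma iaddsW E s p : E p -> iadds E s p.
Proof. by elim: s E => //= a s IHs E Ep; apply/IHs/iaddW. Qed.

Lemma hideal_iadds E s :
  hideal E -> (forall a, a \in s -> exists m, a \is m.-homog) -> hideal (iadds E s).
Proof.
elim: s E => //= a s IHs E hE hs; have [m ha] := hs a (mem_head _ _).
by apply: IHs (hideal_iadd hE ha) _ => b bs; apply: hs; rewrite inE bs orbT.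
Qed.

Lemma iadds_gen E s a :
  hideal E -> (forall a, a \in s -> exists m, a \is m.-homog) -> a \in s ->
  iadds E s a.
Proof.
elim: s E => //= b s IHs E hE hs; have [m hb] := hs b (mem_head _ _).
rewrite inE => /predU1P[->|as_]; first exact/iaddsW/iadd_gen.
by apply: IHs (hideal_iadd hE hb) _ as_ => c cs; apply: hs; rewrite inE cs orbT.
Qed.

Lemma iadds_ind (F : S -> Prop) E s :
    (forall p, E p -> F p) -> (forall p q, F p -> F q -> F (p + q)) ->
    (forall a q, a \in s -> F (a * q)) ->
  forall p, iadds E s p -> F p.
Proof.
move=> + FD; elim: s E => //= a s IHs E EF Fs p; apply: IHs.
  move=> _ [e [q [Ee ->]]]; apply: FD; first exact: EF.
  by apply: Fs; rewrite mem_head.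
by move=> b q bs; apply: Fs; rewrite inE bs orbT.
Qed.

(* An induction principle for the degree d part of an ideal that only meets
   homogeneous cofactors. *)
Lemma iadds_hom_ind d (F : S -> Prop) E s :
    hideal E -> (forall a, a \in s -> exists m, a \is m.-homog) ->
    F 0 -> (forall p q, F p -> F q -> F (p + q)) ->
    (forall p, E p -> p \is d.-homog -> F p) ->
    (forall a m q, a \in s -> a \is m.-homog -> (m <= d)%N ->
      q \is (d - m).-homog -> F (a * q)) ->
  forall p, iadds E s p -> p \is d.-homog -> F p.
Proof.
move=> hE hs F0 FD FE Fs p Ip hp.
suff: F (hcomp d p) by rewrite pihomog_dE.
elim/iadds_ind: Ip => [q Eq|q1 q2 F1 F2|a q as_].
- by apply: FE; [apply: hideal_comp|apply: pihomogP].
- by rewrite raddfD; apply: FD.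
have [m ha] := hs a as_; rewrite (hcompM _ _ ha); case: leqP => // le_md.
by apply: (Fs _ m) => //; apply: pihomogP.
Qed.

(** This is $\dim (S/E)_d \le N$, expressed by representatives in [S]; [spansP] bounds the Hilbert
    series of $S/E$ coefficientwise. *)
Definition spans E d N : Prop :=
  exists b : 'I_N -> S, (forall k, b k \is d.-homog) /\
    forall p, p \is d.-homog -> exists c : 'I_N -> K, E (p - \sum_k c k *: b k).

Definition spansP E P := forall d, spans E d (P`_d)%R.

Lemma spans_mono E F d N : (forall p, E p -> F p) -> spans E d N -> spans F d N.
Proof.
move=> EF [b [hb bP]]; exists b; split=> // p /bP[c Ec].
by exists c; apply: EF.
Qed.

Lemma spans_leq E d N M : (N <= M)%N -> spans E d N -> spans E d M.
Proof.
move=> /subnKC <- [b [hb bP]].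
exists (fun k => match split k with inl k1 => b k1 | inr _ => 0 end).
split=> [k|p /bP[c Ec]]; first by case: split => k' //; apply: dhomog0.
exists (fun k => match split k with inl k1 => c k1 | inr _ => 0 end).
rewrite big_split_ord /= [X in _ - (_ + X)]big1 ?addr0 => [|k _].
  under eq_bigr => k _ do rewrite (unsplitK (inl k)).
  exact: Ec.
by rewrite (unsplitK (inr k)) scale0r.
Qed.

(** Right exactness of $S/(E:a) \to S/E \to S/(E+(a)) \to 0$, the first map being multiplication by
    [a]: a family for $E+(a)$ is completed by [a] times a family for $(E:a)$. *)
Lemma spans_add E a m d N1 N2 : hideal E -> a \is m.-homog ->
    spans (iadd E a) d N1 -> ((m <= d)%N -> spans (icolon E a) (d - m) N2) ->
  spans E d (N1 + N2).
Proof.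
move=> hE ha [b1 [hb1 b1P]].
case: (leqP m d) => [le_md /(_ isT)[b2 [hb2 b2P]]|lt_dm _]; last first.
  apply: (@spans_leq _ _ N1); first exact: leq_addr.
  exists b1; split=> // p hp; have [c [e [q [Ee eqp]]]] := b1P p hp; exists c.
  set p' := p - _; have hp' : p' \is d.-homog.
    by apply: rpredB => //; apply: rpred_sum => k _; apply: rpredZ.
  (* For [d < m] a multiple of [a] has no component of degree [d]. *)
  have -> : p' = hcomp d e.
    rewrite -(pihomog_dE hp') /p' eqp raddfD /= (hcompM _ _ ha).
    by rewrite leqNgt lt_dm addr0.
  exact: hideal_comp.
exists (fun k => match split k with inl k1 => b1 k1 | inr k2 => a * b2 k2 end).
split=> [k|p hp]; first by case: split => k' //; rewrite -(subnKC le_md); apply: dhomogM.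
have [c1 [e [q [Ee eqp]]]] := b1P p hp; pose q' := hcomp (d - m) q.
have [c2 Ec2] := b2P q' (pihomogP _ _ _).
exists (fun k => match split k with inl k1 => c1 k1 | inr k2 => c2 k2 end).
rewrite big_split_ord /=.
under eq_bigr => k _ do rewrite (unsplitK (inl k)).
under [X in _ - (_ + X)]eq_bigr => k _ do rewrite (unsplitK (inr k)).
rewrite opprD addrA; set p' := p - _; have hp' : p' \is d.-homog.
  by apply: rpredB => //; apply: rpred_sum => k _; apply: rpredZ.
have -> : p' = hcomp d e + a * q'.
  by rewrite -(pihomog_dE hp') /p' eqp raddfD /= (hcompM _ _ ha) le_md.
rewrite -addrA; apply: hidealD => //; first exact: hideal_comp.
suff <- : a * (q' - \sum_k c2 k *: b2 k) = a * q' - \sum_k c2 k *: (a * b2 k) by [].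
rewrite mulrBr [X in _ - X]mulr_sumr; congr (_ - _); apply: eq_bigr => k _; exact: esym (scalerAr _ _ _).
Qed.

Lemma spansP_add E a m P Q : hideal E -> a \is m.-homog ->
  spansP (iadd E a) P -> spansP (icolon E a) Q -> spansP E (P + 'X^m * Q).
Proof.
move=> hE ha EP EQ d; rewrite coefD coefXnM.
apply: (spans_add hE ha (EP d)) => le_md.
by rewrite ltnNge le_md; apply: EQ.
Qed.

Lemma spansP_mono E F P : (forall p, E p -> F p) -> spansP E P -> spansP F P.
Proof. by move=> EF EP d; apply: spans_mono (EP d). Qed.

Lemma spansP0 E : hideal E -> E 1 -> spansP E 0.
Proof.
move=> hE E1 d; rewrite coef0; exists (fun=> 0); split=> [[]|p _] //.
by exists (fun=> 0); rewrite big_ord0 subr0 -[p]mulr1; apply: hidealM.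
Qed.

Lemma qnumS m : qnum m.+1 = 1 + 'X * qnum m.
Proof.
rewrite /qnum big_ord_recl expr0 mulr_sumr; congr (_ + _).
by apply: eq_bigr => i _; rewrite exprS.
Qed.

Lemma qnumD m1 m2 : qnum (m1 + m2) = qnum m1 + 'X^m1 * qnum m2.
Proof.
rewrite /qnum big_split_ord /=; congr (_ + _); rewrite mulr_sumr.
by apply: eq_bigr => i _; rewrite exprD.
Qed.

(** Apply [spansP_add] to one factor at a time. The ideal $(E:l)$ contains the product of the
    remaining factors, and contains 1 once none is left; the [i]-th step contributes [P] shifted by
    [i]. *)
Lemma spansP_prod (ls : seq S) E P : hideal E ->
    (forall l, l \in ls -> l \is 1.-homog) -> E (\prod_(l <- ls) l) ->
    (forall l, l \in ls -> spansP (iadd E l) P) ->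
  spansP E (qnum (size ls) * P).
Proof.
elim: ls E => [|l ls IHls] E hE hom_ls Els Ps.
  rewrite big_nil in Els; rewrite /qnum big_ord0 mul0r; exact: spansP0.
have hl : l \is 1.-homog by apply: hom_ls; rewrite mem_head.
rewrite /= qnumS mulrDl mul1r -mulrA -['X]expr1.
apply: (spansP_add hE hl); first by apply: Ps; rewrite mem_head.
apply: IHls; first exact: hideal_icolon hl.
- by move=> l' l's; apply: hom_ls; rewrite inE l's orbT.
- by move: Els; rewrite big_cons.
move=> l' l's; apply: (@spansP_mono (iadd E l')).
  by move=> p; apply: iadd_mono => q; apply: icolonW.
by apply: Ps; rewrite inE l's orbT.
Qed.

(** The reverse bound: $\dim (S/E)_d$ is at least the coefficient of [P] in each degree. *)
Definition tight E P := forall d N, spans E d N -> ((P`_d)%R <= N)%N.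

(** By [spans_add], too small a family for $(E:a)$ would give too small a family for [E]. *)
Lemma tight_icolon E a m P Q : hideal E -> a \is m.-homog ->
  tight E (P + 'X^m * Q) -> spansP (iadd E a) P -> tight (icolon E a) Q.
Proof.
move=> hE ha tE aP d N sN.
have /tE : spans E (m + d) ((P`_(m + d))%R + N).
  by apply: (spans_add hE ha (aP _)) => _; rewrite addKn.
by rewrite coefD coefXnM ltnNge leq_addr addKn /= leq_add2l.
Qed.

Lemma tight_free E d P (b : 'I_((P`_d)%R) -> S) : hideal E -> tight E P ->
    (forall k, b k \is d.-homog) ->
    (forall p, p \is d.-homog -> exists c : 'I_((P`_d)%R) -> K, E (p - \sum_k c k *: b k)) ->
  forall c : 'I_((P`_d)%R) -> K, E (\sum_k c k *: b k) -> forall k, c k = 0.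
Proof.
move=> hE tE; have := tE d; move: (P`_d) b => [|N] b tEd hb bP c Ec k0; first by case: k0.
apply/eqP/negPn/negP => nz_c.
suff /tEd : spans E d N by rewrite ltnn.
exists (fun k => b (lift k0 k)); split=> // p /bP[a Ea].
(* Subtracting [a k0 / c k0] times the relation removes [b k0] from the expansion of [p]. *)
exists (fun k => a (lift k0 k) - a k0 / c k0 * c (lift k0 k)).
apply: (hideal_eqmod hE _ Ea).
rewrite opprD opprK addrACA subrr add0r addrC.
have -> : \sum_k a k *: b k - \sum_k (a (lift k0 k) - a k0 / c k0 * c (lift k0 k)) *:
  b (lift k0 k) = (a k0 / c k0) *: \sum_k c k *: b k.
  rewrite (bigD1_ord k0) //= [in RHS](bigD1_ord k0) //= scalerDr scalerA divfK //.
  rewrite -addrA -sumrB; congr (_ + _); rewrite scaler_sumr.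
  by apply: eq_bigr => k _; rewrite scalerA -scalerBl opprB addrC subrK.
exact: hidealZ.
Qed.

End Ideals.

(** * Ideals containing power sums and products of linear forms *)

Lemma monic_prod_roots (A : idomainType) (rs : seq A) (p : {poly A}) :
    p \is monic -> size p = (size rs).+1 -> uniq rs -> all (root p) rs ->
  p = \prod_(a <- rs) ('X - a%:P).
Proof.
elim: rs p => [|a rs IHrs] p mon_p size_p /=.
  rewrite big_nil => _ _; have := monicP mon_p; rewrite lead_coefE size_p.
  by rewrite {2}[p]size1_polyC ?size_p //= => ->.
case/andP=> nrs_a urs /andP[/factor_theorem[q eqp] /allP rs_p].
have mon_q : q \is monic by rewrite -(monicMr _ (monicXsubC a)) -eqp.
rewrite big_cons mulrC eqp; congr (_ * _); apply: IHrs => //.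
  by move: size_p; rewrite eqp size_Mmonic ?monicXsubC ?monic_neq0 // size_XsubC addn2 => -[].
apply/allP => b rs_b; have := rs_p b rs_b; rewrite eqp rootM root_XsubC.
by case/orP => // /eqP eqba; rewrite -eqba rs_b in nrs_a.
Qed.

Section PowerSums.
Variables (K : fieldType) (n r : nat).
Local Notation S := {mpoly K[n]}.
Implicit Types (E : S -> Prop) (U V W : {set 'I_n}) (a t u v : 'I_n).

Definition powx a : S := 'X_a ^+ r.
Definition psum k : S := \sum_a powx a ^+ k.
Definition vpoly U : {poly S} := \prod_(u in U) ('X - (powx u)%:P).

Lemma homogX a : ('X_a : S) \is 1.-homog.
Proof. by rewrite dhomogX /= mdeg1. Qed.

Lemma homog_powx a : powx a \is r.-homog.
Proof. by rewrite -[X in ishomog1 X]mul1n; apply/dhomogMn/homogX. Qed.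

Lemma homog_psum k : psum k \is (r * k).-homog.
Proof. by apply: rpred_sum => a _; apply/dhomogMn/homog_powx. Qed.

Lemma horner_vpoly U (p : S) : (vpoly U).[p] = \prod_(u in U) (p - powx u).
Proof. by rewrite horner_prod; apply: eq_bigr => u _; rewrite !hornerE. Qed.

Lemma vpoly_root U u : u \in U -> (vpoly U).[powx u] = 0.
Proof. by move=> Uu; rewrite horner_vpoly (bigD1 u) //= subrr mul0r. Qed.

Lemma size_vpoly U : size (vpoly U) = #|U|.+1.
Proof. by rewrite /vpoly -big_enum /= size_prod_XsubC -cardE. Qed.

(** The factor [powx a] raises every exponent by one, so the constant [psum 0] does not occur. *)
Lemma psum_horner (P : {poly S}) :
  \sum_a powx a * P.[powx a] = \sum_(i < size P) P`_i * psum i.+1.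
Proof.
under eq_bigr => a _ do rewrite horner_coef mulr_sumr.
rewrite exchange_big; apply: eq_bigr => i _; rewrite mulr_sumr.
by apply: eq_bigr => a _; rewrite exprS mulrCA.
Qed.

Lemma hideal_psum_horner E (P : {poly S}) :
  hideal E -> (forall k, (k < size P)%N -> E (psum k.+1)) ->
  E (\sum_a powx a * P.[powx a]).
Proof.
move=> hE Ep; rewrite psum_horner; apply: hideal_sum => // i _.
by apply: hidealM => //; apply: Ep.
Qed.

Lemma hideal_horner E (P : {poly S}) (p q : S) :
  hideal E -> E (p - q) -> E (P.[p] - P.[q]).
Proof.
move=> hE Epq; have /factor_theorem[Q eqQ] : root (P - P.[q]%:P) q.
  by rewrite rootE !hornerE subrr.
have := congr1 (fun R => R.[p]) eqQ; rewrite !hornerE => ->.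
exact: hidealM.
Qed.

(** * Filtration by linear forms *)

Section LinearForms.
Variable z : K.
Hypothesis prim_z : r.-primitive_root z.

Let r_gt0 : (0 < r)%N := prim_order_gt0 prim_z.

(** The linear factors of $x_t^e \prod_u (y_t - y_u)$, where each $y_t - y_u$ splits as $\prod_s
    (x_t - z^s x_u)$. *)
Definition lforms t e (us : seq 'I_n) : seq S :=
  nseq e 'X_t ++ [seq 'X_t - z ^+ s *: 'X_u | u <- us, s <- iota 0 r].

Lemma size_lforms t e us : size (lforms t e us) = (e + size us * r)%N.
Proof. by rewrite size_cat size_nseq size_allpairs size_iota. Qed.

Lemma prod_subX_root (p q : S) : \prod_(s < r) (p - z ^+ s *: q) = p ^+ r - q ^+ r.
Proof.
have eqP : 'X^r - (q ^+ r)%:P = \prod_(s < r) ('X - (z ^+ s *: q)%:P) :> {poly S}.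
  (* The roots $z^s q$ are distinct only for nonzero [q]. *)
  have [->|nz_q] := eqVneq q 0.
    rewrite expr0n gtn_eqF // polyC0 subr0.
    under eq_bigr => s _ do rewrite scaler0 polyC0 subr0.
    by rewrite prodr_const card_ord.
  have sz : size ('X^r - (q ^+ r)%:P) = r.+1.
    rewrite size_polyDl size_polyXn // size_polyN ltnS.
    by rewrite (leq_trans (size_polyC_leq1 _)).
  have mon : 'X^r - (q ^+ r)%:P \is monic.
    rewrite monicE lead_coefDl ?lead_coefXn // size_polyN size_polyXn ltnS.
    by rewrite (leq_trans (size_polyC_leq1 _)).
  rewrite (@monic_prod_roots _ [seq z ^+ s *: q | s <- index_iota 0 r] _ mon).
  - by rewrite big_map big_mkord.
  - by rewrite size_map size_iota subn0.
  - rewrite map_inj_in_uniq ?iota_uniq // => s1 s2.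
    rewrite !mem_index_iota /= => lt1 lt2 /eqP; rewrite -subr_eq0 -scalerBl -mul_mpolyC.
    rewrite mulf_eq0 (negPf nz_q) orbF mpolyC_eq0 subr_eq0.
    by rewrite (eq_prim_root_expr prim_z) !modn_small // => /eqP.
  apply/allP => _ /mapP[s _ ->]; rewrite rootE !hornerE exprZn -exprM mulnC exprM.
  by rewrite (prim_expr_order prim_z) expr1n scale1r subrr.
transitivity ('X^r - (q ^+ r)%:P).[p]; last by rewrite hornerD hornerN hornerXn hornerC.
by rewrite eqP horner_prod; apply: eq_bigr => s _; rewrite hornerXsubC.
Qed.

Lemma prod_lforms t e us :
  \prod_(l <- lforms t e us) l = 'X_t ^+ e * \prod_(u <- us) (powx t - powx u).
Proof.
rewrite big_cat /=; congr (_ * _); first by rewrite big_nseq iter_mulr_1.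
rewrite big_allpairs_dep /=; apply: eq_bigr => u _.
by rewrite -prod_subX_root -(big_mkord xpredT (fun s => 'X_t - z ^+ s *: 'X_u)) /index_iota subn0.
Qed.

Lemma homog_lforms t e us l : l \in lforms t e us -> l \is 1.-homog.
Proof.
rewrite mem_cat => /orP[/nseqP[-> _]|/allpairsP[[u s] [_ _ ->]]]; first exact: homogX.
by apply: rpredB; [|apply: rpredZ]; apply: homogX.
Qed.

(* Modulo E the coordinates outside V are eliminated. *)
Definition reduced E V a :=
  E 'X_a \/ exists2 v, v \in V & exists2 w : K, w ^+ r = 1 & E ('X_a - w *: 'X_v).

Lemma reduced_setT E a : hideal E -> reduced E [set: 'I_n] a.
Proof.
move=> hE; right; exists a => //; exists 1; rewrite ?expr1n // scale1r subrr.
exact: hideal0.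
Qed.

Lemma reduced_lform E W t e us l : hideal E -> (forall a, reduced E W a) ->
    {subset us <= W :\ t} -> l \in lforms t e us ->
  forall a, reduced (iadd E l) (W :\ t) a.
Proof.
move=> hE redE usW ls a; have hl := homog_lforms ls.
have hE' := hideal_iadd hE hl.
have [Ea|[v Wv [w w1 Eav]]] := redE a; first by left; apply: iaddW.
have [eqvt|nevt] := eqVneq v t; last first.
  by right; exists v; [rewrite !inE nevt|exists w => //; apply: iaddW].
rewrite eqvt in Eav; move: ls; rewrite mem_cat.
case/orP=> [/nseqP[eql _]|/allpairsP[[u s] [/usW Wu _ /= eql]]].
  left; apply: (hideal_eqmod hE' (iaddW _ Eav)).
  by apply: hidealZ => //; rewrite -eql; apply: iadd_gen.
right; exists u => //; exists (w * z ^+ s).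
  by rewrite exprMn w1 -exprM mulnC exprM (prim_expr_order prim_z) expr1n mul1r.
have -> : 'X_a - (w * z ^+ s) *: 'X_u = 'X_a - w *: 'X_t + w *: l.
  by rewrite eql scalerBr scalerA addrA subrK.
by apply: hidealD => //; [apply: iaddW|apply: hidealZ => //; apply: iadd_gen].
Qed.

Hypothesis char0 : [pchar K] =i pred0.

(* For P the product of the t - y_u, u in V minus v, the combination
   \sum_a y_a P(y_a) of power sums is modulo E a positive multiple of its term at v,
   because each y_a is modulo E either 0 or some y_u with u in V. *)
Lemma reduced_prod_lforms E V v : hideal E -> (forall k, E (psum k.+1)) ->
    (forall a, reduced E V a) -> v \in V ->
  E (\prod_(l <- lforms v r (enum (V :\ v))) l).
Proof.
move=> hE Ep redE Vv; set P := vpoly (V :\ v).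
have -> : \prod_(l <- lforms v r (enum (V :\ v))) l = powx v * P.[powx v].
  by rewrite prod_lforms horner_vpoly -big_enum.
set w := powx v * _.
have redP a : exists b : bool, E (powx a * P.[powx a] - w *+ b) /\ (a == v -> b).
  have [->|neav] := eqVneq a v.
    by exists true; rewrite subrr; split=> //; apply: hideal0.
  have powE b (x : S) : E ('X_b - x) -> E (powx b - x ^+ r).
    by move=> Eb; rewrite subrXX; apply: hidealMr.
  have [Ea|[u Vu [c c1 Eau]]] := redE a.
    exists false; split=> //; rewrite subr0; apply: hidealMr => //.
    have := @powE a 0; rewrite expr0n gtn_eqF // !subr0; exact.
  have := powE _ _ Eau; rewrite exprZn c1 scale1r => Eau'.
  have EP : E (powx a * P.[powx a] - powx u * P.[powx u]).
    have := hideal_horner ('X * P) hE Eau'; by rewrite !hornerE.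
  have [equv|neuv] := eqVneq u v.
    by exists true; split; [rewrite mulr1n; move: EP; rewrite equv|].
  exists false; split=> //; move: EP; rewrite (@vpoly_root _ u) ?mulr0 //.
  by rewrite !inE neuv.
have [b bP] := fin_all_exists redP.
have sumE : E (w *+ \sum_a b a).
  rewrite -sumrMnr; apply: (hideal_eqmod hE _ (@hideal_psum_horner E P hE _)); last first.
    by move=> k _; apply: Ep.
  rewrite -sumrB; apply: hideal_sum => // a _.
  by rewrite -opprB; apply: hidealN => //; have [] := bP a.
have : (0 < \sum_a b a)%N.
  by rewrite (bigD1 v) //=; case: (bP v) => _ ->.
case: (\sum_a _)%N sumE => // m sumE _.
have nz_m : m.+1%:R != 0 :> K by rewrite ((pcharf0P K).1 char0).
rewrite -[w](scalerK nz_m) scaler_nat; exact: hidealZ.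
Qed.

Lemma hideal_pos_homog E d (p : S) : hideal E -> (forall a, E 'X_a) -> (0 < d)%N ->
  p \is d.-homog -> E p.
Proof.
move=> hE EX d_gt0 /dhomogP hp; rewrite [p]mpolyE big_seq.
apply: hideal_sum => // m /hp /= degm; apply: hidealZ => //.
have [a nza] : exists a, (m a != 0)%N.
  apply/existsP; move: d_gt0; rewrite -degm mdegE; apply: contraTT.
  by rewrite negb_exists => /forallP m0; rewrite big1 // => a _; apply/eqP/negPn/m0.
rewrite mpolyXE_id (bigD1 a) //=; apply: hidealMr => //.
by case: (m a) nza => // k _; rewrite exprS; apply: hidealMr.
Qed.

(** Induction on [#|V|]. For [v] in [V], [reduced_prod_lforms] puts a product of [r * #|V|] linear
    forms into [E], and each of them eliminates [v]. When [V] is empty all variables lie in [E] and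
    only constants remain. *)
Lemma spansP_reduced E V : hideal E -> (forall k, E (psum k.+1)) ->
    (forall a, reduced E V a) ->
  spansP E (\prod_(i < #|V|) qnum (r * i.+1)).
Proof.
move: {2}#|V| (erefl #|V|) => k; elim: k E V => [|k IHk] E V cardV hE Ep redE.
  rewrite cardV big_ord0 => -[|d]; rewrite coef1 /=; last first.
    exists (fun=> 0); split=> [[]|p hp] //; exists (fun=> 0); rewrite big_ord0 subr0.
    apply: hideal_pos_homog hp => // a; case: (redE a) => // -[v].
    by rewrite (cards0_eq cardV) inE.
  exists (fun=> 1); split=> [k|p hp]; first exact: dhomog1.
  exists (fun=> p@_0); rewrite big_ord1.
  suff -> : p - p@_0 *: 1 = 0 by apply: hideal0.
  apply/mpolyP => m; rewrite mcoeffB mcoeffZ mcoeff1 mcoeff0.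
  have [->|nz_m] := eqVneq m 0%MM; first by rewrite mulr1 subrr.
  by rewrite mulr0 subr0 (dhomog_nemf_coeff hp) // mdeg_eq0.
have [v Vv] : exists v, v \in V by apply/set0Pn; rewrite -card_gt0 cardV.
have cardV' : #|V :\ v| = k by move: cardV; rewrite (cardsD1 v) Vv => -[].
rewrite cardV big_ord_recr /= mulrC.
have -> : (r * k.+1)%N = size (lforms v r (enum (V :\ v))).
  by rewrite size_lforms -cardE cardV' mulnS mulnC.
apply: spansP_prod => //; first exact: homog_lforms.
  exact: reduced_prod_lforms.
move=> l ls; rewrite -cardV'; apply: IHk => //.
- exact: hideal_iadd (homog_lforms ls).
- by move=> i; apply: iaddW.
by apply: reduced_lform ls => // u; rewrite mem_enum.
Qed.

(** Eliminate the elements of [ts] first, each through its own product, then use [spansP_reduced].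
    As [us t] avoids [ts], eliminating one element of [ts] does not disturb the products of the
    others. *)
Lemma spansP_lforms (e : 'I_n -> nat) (us : 'I_n -> seq 'I_n) (ts : seq 'I_n) E W :
    uniq ts -> {subset ts <= W} -> hideal E -> (forall k, E (psum k.+1)) ->
    (forall a, reduced E W a) ->
    {in ts, forall t, {subset us t <= [predD W & ts]} /\
                      E (\prod_(l <- lforms t (e t) (us t)) l)} ->
  spansP E ((\prod_(t <- ts) qnum (e t + size (us t) * r)) *
            \prod_(i < #|W| - size ts) qnum (r * i.+1)).
Proof.
elim: ts E W => [|t ts IHts] E W /=.
  move=> _ _ hE Ep redE _; rewrite big_nil mul1r subn0; exact: spansP_reduced.
case/andP=> nts uts tsW hE Ep redE lfE; rewrite big_cons -mulrA -(size_lforms t).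
have [usW Et] := lfE t (mem_head _ _).
have Wt : t \in W by apply/tsW/mem_head.
apply: spansP_prod => //; first exact: homog_lforms.
move=> l ls; have -> : (#|W| - (size ts).+1)%N = (#|W :\ t| - size ts)%N.
  by rewrite [in LHS](cardsD1 t) Wt subSS.
have hE' := hideal_iadd hE (homog_lforms ls).
apply: IHts => //.
- move=> t' ts_t'; rewrite !inE tsW ?inE ?ts_t' ?orbT // andbT.
  by apply: contraNneq nts => <-.
- by move=> k; apply: iaddW.
- apply: reduced_lform ls => // u /usW; rewrite !inE negb_or.
  by case/andP=> /andP[-> _] ->.
move=> t' ts_t'; have tts_t' : t' \in t :: ts by rewrite inE ts_t' orbT.
have [usW' Et'] := lfE t' tts_t'.
split; last exact: iaddW.
by move=> u /usW'; rewrite !inE negb_or => /andP[/andP[-> ->] ->].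
Qed.

End LinearForms.

End PowerSums.

(** * Tightness for the coinvariant ideal *)

Section Geometric.

(** The first [D] terms of $1/(1-q^m)$; for [m > 0] the two agree below degree [D]. *)
Definition geom D m : {poly nat} := \sum_(t < D) 'X^(t * m).

Lemma geom_rec D m : geom D m + 'X^(D * m) = 1 + 'X^m * geom D m.
Proof.
rewrite /geom -(big_ord_recr D (fun t => 'X^(t * m))) big_ord_recl expr0 mulr_sumr.
by congr (_ + _); apply: eq_bigr => t _; rewrite -exprD.
Qed.

Lemma qnum_geom D m : geom D m * qnum m = qnum (D * m).
Proof.
rewrite /geom; elim: D => [|D IHD]; first by rewrite big_ord0 mul0r /qnum big_ord0.
by rewrite big_ord_recr /= mulrDl IHD mulSnr qnumD.
Qed.

Lemma coef_geom0 D m : (0 < D)%N -> (0 < ((geom D m)`_0)%R)%N.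
Proof.
by case: D => // D _; rewrite coef_sum big_ord_recl coefXn mul0n.
Qed.

Lemma coef_prod_qnum n (m : 'I_n -> nat) M d : (forall i, (m i <= M)%N) ->
  ((\prod_i qnum (m i))`_d)%R =
  #|[set f : {ffun 'I_n -> 'I_M} | [forall i, (f i < m i)%N] && ((\sum_i f i)%N == d)]|.
Proof.
move=> mM.
have qE i : qnum (m i) = \sum_(a < M | (a < m i)%N) 'X^a.
  by rewrite /qnum (big_ord_widen _ (fun a => 'X^a) (mM i)).
under eq_bigr => i _ do rewrite qE.
rewrite bigA_distr_big_dep coef_sum -sum1_card [RHS]big_mkcond [LHS]big_mkcond.
apply: eq_bigr => f _; rewrite inE.
have -> : (f \in family (fun i (a : 'I_M) => (a < m i)%N)) = [forall i, (f i < m i)%N].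
  by apply/familyP/forallP.
case: forallP => //= _; rewrite prodrXr coefXn eq_sym.
by case: eqP.
Qed.

End Geometric.

Section Tightness.
Variables (K : fieldType) (n : nat).
Local Notation S := {mpoly K[n]}.
Implicit Types (E : S -> Prop) (P Q : {poly nat}).

Definition zero_ideal : S -> Prop := fun p => p = 0.

Lemma hideal_zero : hideal zero_ideal.
Proof.
split; rewrite /zero_ideal => //.
- by move=> p q -> ->; rewrite addr0.
- by move=> q p ->; rewrite mulr0.
- by move=> d p ->; rewrite raddf0.
Qed.

(** The coefficient counts the monomials of degree [d] with exponents bounded by [m], and these are
    linearly independent. *)
Lemma spans_zero_ideal (m : 'I_n -> nat) d N :
  spans zero_ideal d N -> (((\prod_i qnum (m i))`_d)%R <= N)%N.
Proof.
case=> b [_ bP]; rewrite (@coef_prod_qnum _ _ (\max_i m i)) => [|i]; last first.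
  exact: leq_bigmax.
set T := [set f | _]; pose mon (f : {ffun 'I_n -> 'I_(\max_i m i)}) : 'X_{1..n} :=
  [multinom (f i : nat) | i < n].
have mon_inj : injective mon.
  move=> f1 f2 eqf; apply/ffunP => i; apply/val_inj.
  by have := congr1 (fun u : 'X_{1..n} => u i) eqf; rewrite !mnmE.
pose v (k : 'I_#|T|) : S := 'X_[mon (enum_val k)].
have /fin_all_exists[A AP] k : exists c : 'I_N -> K, v k = \sum_l c l *: b l.
  have [|c /eqP] := bP (v k); last by rewrite subr_eq0 => /eqP; exists c.
  rewrite dhomogX /= mdegE; have := enum_valP k; rewrite inE => /andP[_ /eqP <-].
  by apply/eqP/eq_bigr => i _; rewrite mnmE.
apply: (@free_leq_span _ _ _ _ v b (\matrix_(k, l) A k l)) => [k|c c0 k].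
  by rewrite AP; apply: eq_bigr => l _; rewrite mxE.
have := congr1 (mcoeff (mon (enum_val k))) c0; rewrite mcoeff0 raddf_sum /=.
rewrite (bigD1 k) //= mcoeffZ mcoeffX eqxx mulr1 big1 ?addr0 // => l nelk.
rewrite mcoeffZ mcoeffX; case: eqP => [/mon_inj/enum_val_inj eqlk|]; last by rewrite mulr0.
by rewrite eqlk eqxx in nelk.
Qed.

Definition spansT D E P := forall d, (d < D)%N -> spans E d (P`_d)%R.

(** Expand along powers of [a], with coefficients in the family for $E+(a)$. The truncation error in
    [geom_rec] starts in degree [D * m >= D]. *)
Lemma spansT_geom D E a m P : hideal E -> a \is m.-homog -> (0 < m)%N ->
  spansT D (iadd E a) P -> spansT D E (geom D m * P).
Proof.
move=> hE ha m_gt0 EP d; elim/ltn_ind: d => d IHd ltdD.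
have -> : (geom D m * P)`_d = P`_d + ('X^m * (geom D m * P))`_d.
  have := congr1 (fun R => (R * P)`_d) (geom_rec D m).
  rewrite !mulrDl !coefD mul1r mulrA => <-; rewrite coefXnM.
  by rewrite (leq_trans ltdD) ?leq_pmulr // addr0.
apply: (spans_add hE ha); first exact: EP.
move=> le_md; rewrite coefXnM ltnNge le_md; apply: (@spans_mono _ _ E).
  by move=> p; apply: icolonW.
by apply: IHd; lia.
Qed.

End Tightness.

Section Coinvariants.
Variables (K : fieldType) (n r : nat).
Hypothesis r_gt0 : (0 < r)%N.
Local Notation S := {mpoly K[n]}.
Implicit Types (E : S -> Prop) (P Q : {poly nat}).

(** The ideal $I$, given by its first [n] power sums since the number and degrees of the generators
    matter in [tight_coinv]; [coinv_psum] supplies the others. *)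
Definition coinv_ideal : S -> Prop :=
  iadds (@zero_ideal K n) [seq psum K n r k.+1 | k <- iota 0 n].

Lemma homog_psums (ks : seq nat) a :
  a \in [seq psum K n r k.+1 | k <- ks] -> exists m, a \is m.-homog.
Proof. by case/mapP => k _ ->; exists (r * k.+1)%N; apply: homog_psum. Qed.

Lemma hideal_coinv : hideal coinv_ideal.
Proof. exact: hideal_iadds (hideal_zero _ _) (@homog_psums _). Qed.

Lemma coinv_psum k : coinv_ideal (psum K n r k.+1).
Proof.
have hI := hideal_coinv; elim/ltn_ind: k => k IHk.
case: (ltnP k n) => [lt_kn|le_nk].
  apply: (iadds_gen (hideal_zero _ _) (@homog_psums _)).
  by apply/mapP; exists k; rewrite ?mem_iota.
(* This monic polynomial of degree [k] vanishes at every $y_a$, so [psum_horner] expresses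
   [psum k.+1] through lower power sums. *)
pose P := 'X^(k - n) * vpoly K r [set: 'I_n].
have mon_v : vpoly K r [set: 'I_n] \is monic by apply: monic_prod_XsubC.
have sizeP : size P = k.+1.
  rewrite size_monicM ?monicXn ?monic_neq0 // size_polyXn size_vpoly cardsT card_ord.
  by lia.
have P0 : \sum_a powx K r a * P.[powx K r a] = 0.
  by apply: big1 => a _; rewrite /P hornerM vpoly_root ?inE // !mulr0.
have lcP : P`_k = 1.
  have /monicP : P \is monic by rewrite rpredM ?monicXn.
  by rewrite lead_coefE sizeP.
move: P0; rewrite psum_horner sizeP big_ord_recr /= lcP mul1r addrC => /eqP.
rewrite addr_eq0 => /eqP ->; apply: hidealN => //; apply: hideal_sum => // i _.
by apply: hidealM => //; apply: IHk.
Qed.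

Lemma coinv_sub (F : S -> Prop) :
  F 0 -> (forall p q, F p -> F q -> F (p + q)) ->
  (forall k q, F (psum K n r k.+1 * q)) -> forall p, coinv_ideal p -> F p.
Proof.
move=> F0 FD Fp; apply: iadds_ind FD _ => [p ->|_ q /mapP[k _ ->]] //.
Qed.

Lemma spansT_psums D E ks P : hideal E ->
  spansT D (iadds E [seq psum K n r k.+1 | k <- ks]) P ->
  spansT D E ((\prod_(k <- ks) geom D (r * k.+1)) * P).
Proof.
elim: ks E => [|k ks IHks] E hE; first by rewrite big_nil mul1r.
move=> /= /IHks; rewrite big_cons -mulrA => EP.
have hk := homog_psum K n r k.+1.
apply: spansT_geom hk _ (EP (hideal_iadd hE hk)) => //.
by rewrite muln_gt0 r_gt0.
Qed.

(* Graded Nakayama: S is generated over the power sums by representatives of a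
   spanning family of the quotient; comparing with the number of all monomials
   shows that this family cannot be too small. *)
Lemma tight_coinv :
  spansP coinv_ideal (\prod_(i < n) qnum (r * i.+1)) ->
  tight coinv_ideal (\prod_(i < n) qnum (r * i.+1)).
Proof.
set H := \prod_(i < n) _ => spH d N sN; pose D := d.+1.
(* [H] with its coefficient in degree [d] replaced by [N]. *)
pose H' := \poly_(i < D) (if i == d then N else H`_i)%R.
have spH' : spansT D coinv_ideal H'.
  move=> e lt_eD; rewrite coef_poly lt_eD.
  by case: eqP => [->|_] //; apply: spH.
have := spansT_psums (hideal_zero _ _) spH' (ltnSn d).
set G := \prod_(k <- _) _.
(* [G * H] counts monomials in a box, so its coefficient in degree [d] is at most that of [G * H'];
   the two sums differ only in the term containing the constant coefficient of [G], which is
   positive. *)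
have GH : \prod_(i < n) qnum (D * (r * i.+1)) = G * H.
  rewrite /G -[n in iota 0 n]subn0 -/(index_iota 0 n) big_mkord -big_split /=.
  by apply: eq_bigr => i _; rewrite qnum_geom.
move/(spans_zero_ideal (fun i : 'I_n => D * (r * i.+1)))%N; rewrite GH !coefM.
rewrite !big_ord_recl !subn0 coef_poly ltnSn eqxx.
have -> : \sum_(i < d) G`_(lift ord0 i) * H'`_(d - lift ord0 i) =
          \sum_(i < d) G`_(lift ord0 i) * H`_(d - lift ord0 i).
  apply: eq_bigr => i _; have lt_d : (d - lift ord0 i < d)%N.
    by rewrite lift0; have := ltn_ord i; lia.
  by rewrite coef_poly (ltn_trans lt_d (ltnSn d)) ltn_eqF.
rewrite [X in (X <= _)%N -> _]addrC [X in (_ <= X)%N -> _]addrC leq_add2l.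
rewrite leq_pmul2l // /G.
elim: (iota 0 n) => [|k ks IHks]; first by rewrite big_nil coef1.
by rewrite big_cons coef0M muln_gt0 IHks coef_geom0.
Qed.

End Coinvariants.

(** * Colon ideals *)

Section Colon.
Variables (K : fieldType) (n r : nat) (z : K).
Hypothesis prim_z : r.-primitive_root z.
Hypothesis char0 : [pchar K] =i pred0.
Local Notation S := {mpoly K[n]}.
Local Notation powx := (@powx K n r).
Local Notation psum := (psum K n r).
Local Notation coinv := (@coinv_ideal K n r).
Local Notation lforms := (@lforms K n r z).
Implicit Types (J U : {set 'I_n}) (a t u v j : 'I_n).

Let r_gt0 : (0 < r)%N := prim_order_gt0 prim_z.

Definition above j : {set 'I_n} := [set u : 'I_n | (j < u)%N].
Definition below J j : {set 'I_n} := [set u in ~: J | (u < j)%N].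

(** [colon_poly J] is $f_J$, with [colon_factor j] as $f_{j}$; [stair_gen J j] is $g_j$ and
    [stair_poly J] is $H_J$. *)
Definition colon_factor j : S := 'X_j * \prod_(u in above j) (powx j - powx u).
Definition colon_poly J : S := \prod_(j in J) colon_factor j.
Definition stair_gen J j : S := 'X_j ^+ r.-1 * \prod_(u in below J j) (powx j - powx u).
Definition stair_size J j : nat := (r.-1 + #|below J j| * r)%N.
Definition stair_poly J : {poly nat} :=
  (\prod_(j in J) qnum (stair_size J j)) * \prod_(i < n - #|J|) qnum (r * i.+1).
Definition stair_ideal J : S -> Prop := iadds coinv [seq stair_gen J j | j <- enum J].
Definition colon_ideal J : S -> Prop := icolon coinv (colon_poly J).

Lemma homog_prod_linear (ls : seq S) : (forall l, l \in ls -> l \is 1.-homog) ->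
  \prod_(l <- ls) l \is (size ls).-homog.
Proof.
elim: ls => [|l ls IHls] hls; first by rewrite big_nil; apply: dhomog1.
rewrite big_cons -[size _]add1n; apply: dhomogM; first by apply: hls; rewrite mem_head.
by apply: IHls => l' l's; apply: hls; rewrite inE l's orbT.
Qed.

Lemma prod_lforms_set t e U :
  \prod_(l <- lforms t e (enum U)) l = 'X_t ^+ e * \prod_(u in U) (powx t - powx u).
Proof. by rewrite prod_lforms // -big_enum. Qed.

Lemma homog_lforms_prod t e U :
  'X_t ^+ e * \prod_(u in U) (powx t - powx u) \is (e + #|U| * r).-homog.
Proof.
rewrite -prod_lforms_set cardE -(size_lforms r z t); apply: homog_prod_linear => l.
exact: homog_lforms.
Qed.

Lemma homog_colon_factor j : colon_factor j \is (1 + #|above j| * r).-homog.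
Proof. exact: homog_lforms_prod. Qed.

Lemma homog_stair_gen J j : stair_gen J j \is (stair_size J j).-homog.
Proof. exact: homog_lforms_prod. Qed.

Lemma homog_colon_poly J : exists m, colon_poly J \is m.-homog.
Proof.
rewrite /colon_poly; elim/big_ind: _ => [|p q [m hp] [m' hq]|j _].
- by exists 0%N; apply: dhomog1.
- by exists (m + m')%N; apply: dhomogM.
by exists (1 + #|above j| * r)%N; apply: homog_colon_factor.
Qed.

Lemma homog_stair_gens J p : p \in [seq stair_gen J j | j <- enum J] ->
  exists m, p \is m.-homog.
Proof. by case/mapP => j _ ->; exists (stair_size J j); apply: homog_stair_gen. Qed.

Lemma hideal_colon J : hideal (colon_ideal J).
Proof.
have [m hJ] := homog_colon_poly J. refine (hideal_icolon (hideal_coinv K n r) hJ).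
Qed.

Lemma hideal_stair J : hideal (stair_ideal J).
Proof. exact: hideal_iadds (hideal_coinv K n r) (@homog_stair_gens J). Qed.

Lemma colon_psum J k : colon_ideal J (psum k.+1).
Proof. by apply: icolonW; [apply: hideal_coinv|apply: coinv_psum]. Qed.

Lemma stair_psum J k : stair_ideal J (psum k.+1).
Proof. by apply: iaddsW; apply: coinv_psum. Qed.

Lemma spansP_stair_ideal J : spansP (stair_ideal J) (stair_poly J).
Proof.
have -> : stair_poly J = (\prod_(j <- enum J) qnum (r.-1 + size (enum (below J j)) * r)) *
    \prod_(i < #|[set: 'I_n]| - size (enum J)) qnum (r * i.+1).
  rewrite cardsT card_ord -cardE /stair_poly -big_enum.
  by under [in RHS]eq_bigr => j _ do rewrite -cardE.
apply: (spansP_lforms prim_z char0 (enum_uniq _) _ (hideal_stair J) (stair_psum J)).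
- by move=> j; rewrite inE.
- by move=> a; apply/reduced_setT/hideal_stair.
move=> j Jj; split.
  by move=> u; rewrite mem_enum !inE mem_enum => /andP[->].
rewrite prod_lforms_set -/(stair_gen J j); apply: (iadds_gen (hideal_coinv K n r)).
  exact: homog_stair_gens.
exact: map_f.
Qed.

Lemma below_setD1 J j j' : (j' < j)%N -> below (J :\ j) j' = below J j'.
Proof.
move=> lt_j'j; apply/setP => u; rewrite !inE negb_and negbK.
by case: eqP => //= ->; rewrite ltnNge (ltnW lt_j'j) !andbF.
Qed.

(** Consequently, for [j] the maximum of [J], $f_{j} g_j$ is $y_j$ times the product of $y_j - y_u$
    over all [u] outside [J]. *)
Lemma setC_max J j : j \in J -> (forall j', j' \in J -> (j' <= j)%N) ->
  ~: J = above j :|: below J j /\ [disjoint above j & below J j].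
Proof.
move=> Jj maxj; split.
  apply/setP => u; rewrite !inE; case Ju: (u \in J) => /=.
    by rewrite orbF ltnNge maxj.
  by case: ltngtP => // /val_inj equj; rewrite equj Ju in Jj.
rewrite -setI_eq0; apply/eqP/setP => u; rewrite !inE.
by case: ltngtP; rewrite ?andbF.
Qed.

(* Evaluate \sum_a y_a P(y_a), a combination of power sums, for P the product of
   the t - y_u with u outside J: modulo the ideal of J minus j only the term of
   index j survives. *)
Lemma stair_gen_colon_max J j : j \in J -> (forall j', j' \in J -> (j' <= j)%N) ->
    (forall j', j' \in J :\ j -> colon_ideal (J :\ j) (stair_gen (J :\ j) j')) ->
  colon_ideal (J :\ j) (colon_factor j * stair_gen J j).
Proof.
move=> Jj maxj gensJ'; have hE := hideal_colon (J :\ j).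
have [eqC dC] := setC_max Jj maxj.
have := hideal_psum_horner (P := vpoly K r (~: J)) hE (fun k _ => colon_psum _ k).
rewrite (bigD1 j) //= => Esum.
have -> : colon_factor j * stair_gen J j = powx j * (vpoly K r (~: J)).[powx j].
  rewrite /colon_factor /stair_gen mulrACA -exprS prednK //; congr (_ * _).
  by rewrite horner_vpoly -bigU //; apply: eq_bigl => u; rewrite eqC !inE.
apply: (hideal_eqmod hE _ Esum); rewrite opprD addrA subrr add0r.
apply: hidealN => //; apply: hideal_sum => // a neaj.
case Ja: (a \in J); last first.
  by rewrite vpoly_root ?inE ?Ja // mulr0; apply: hideal0.
have J'a : a \in J :\ j by rewrite !inE neaj.
have lt_aj : (a < j)%N by rewrite ltn_neqAle maxj // andbT.
have subC : below J a \subset ~: J by apply/subsetP => u; rewrite inE => /andP[].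
have powE : powx a = 'X_a * 'X_a ^+ r.-1 by rewrite -exprS prednK.
have := gensJ' a J'a; rewrite /stair_gen below_setD1 // => EA.
rewrite horner_vpoly (big_setID (below J a)) (setIidPr subC) /=.
set A := \prod_(u in below J a) _ in EA *; set B := \prod_(u in _) _.
have -> : powx a * (A * B) = ('X_a * B) * ('X_a ^+ r.-1 * A) by rewrite powE; ring.
exact: hidealM.
Qed.

Lemma colon_poly_setD1 J j p : j \in J ->
  colon_ideal J p <-> icolon (colon_ideal (J :\ j)) (colon_factor j) p.
Proof.
by move=> Jj; rewrite /colon_ideal /icolon /colon_poly (big_setD1 j Jj) /= mulrCA mulrA.
Qed.

(** Use [spansP_lforms] with [ts] listing [J]. The product for [t != j] is $g_t$; the one for [j] is
    the added generator, whose indices [above j] avoid [J] by maximality. *)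
Lemma spansP_colon_add J j : j \in J -> (forall j', j' \in J -> (j' <= j)%N) ->
    (forall j', j' \in J :\ j -> colon_ideal (J :\ j) (stair_gen (J :\ j) j')) ->
  spansP (iadd (colon_ideal (J :\ j)) (colon_factor j))
    (qnum (1 + #|above j| * r) *
     ((\prod_(j' in J :\ j) qnum (stair_size J j')) * \prod_(i < n - #|J|) qnum (r * i.+1))).
Proof.
move=> Jj maxj gensJ'; have hE := hideal_colon (J :\ j).
have [eqC _] := setC_max Jj maxj.
pose e t := if t == j then 1%N else r.-1.
pose U t := if t == j then above j else below J t.
have hE' := hideal_iadd hE (homog_colon_factor j).
have -> : qnum (1 + #|above j| * r) * ((\prod_(j' in J :\ j) qnum (stair_size J j')) *
    \prod_(i < n - #|J|) qnum (r * i.+1)) =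
  (\prod_(t <- enum J) qnum (e t + size (enum (U t)) * r)) *
    \prod_(i < #|[set: 'I_n]| - size (enum J)) qnum (r * i.+1).
  rewrite cardsT card_ord -cardE big_enum /= (big_setD1 j Jj) /= mulrA.
  rewrite /e /U eqxx -cardE; congr (_ * _ * _); apply: eq_bigr => t.
  by rewrite !inE => /andP[/negPf -> _]; rewrite -cardE.
apply: (spansP_lforms prim_z char0 (enum_uniq _) _ hE').
- by move=> t; rewrite inE.
- by move=> k; apply/iaddW/colon_psum.
- by move=> a; apply: reduced_setT.
move=> t; rewrite mem_enum => Jt; split.
  move=> u; rewrite mem_enum => Uu; rewrite !inE mem_enum andbT -in_setC.
  move: Uu; rewrite /U; case: eqP => _; first by move=> Au; rewrite eqC inE Au.
  by rewrite inE => /andP[].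
rewrite prod_lforms_set /e /U; have [->|netj] := eqVneq t j; first exact: iadd_gen.
apply: iaddW; have J't : t \in J :\ j by rewrite !inE netj.
have := gensJ' t J't; rewrite /stair_gen below_setD1 //.
by rewrite ltn_neqAle maxj // andbT.
Qed.

(** The degrees of $f_{j}$ and $g_j$ add up to [r * (n - #|J|).+1], so [qnumD] splits the last
    factor of [stair_poly (J :\ j)] accordingly. *)
Lemma stair_poly_setD1 J j : j \in J -> (forall j', j' \in J -> (j' <= j)%N) ->
  stair_poly (J :\ j) =
    qnum (1 + #|above j| * r) *
     ((\prod_(j' in J :\ j) qnum (stair_size J j')) * \prod_(i < n - #|J|) qnum (r * i.+1))
    + 'X^(1 + #|above j| * r) * stair_poly J.
Proof.
move=> Jj maxj; have [eqC dC] := setC_max Jj maxj.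
have cardC : (#|above j| + #|below J j| = n - #|J|)%N.
  have := cardsU (above j) (below J j); rewrite (disjoint_setI0 dC) cards0 subn0 => <-.
  by rewrite -eqC cardsCs setCK card_ord.
have cardJ : (n - #|J :\ j| = (n - #|J|).+1)%N.
  by have := subset_leq_card (subsetT J); rewrite cardsT card_ord (cardsD1 j J) Jj add1n => /subnSK ->.
rewrite {1}/stair_poly cardJ big_ord_recr /=.
have -> : \prod_(j' in J :\ j) qnum (stair_size (J :\ j) j') =
          \prod_(j' in J :\ j) qnum (stair_size J j').
  apply: eq_bigr => j'; rewrite !inE => /andP[nej'j Jj'].
  by rewrite /stair_size below_setD1 // ltn_neqAle nej'j maxj.
have -> : (r * (n - #|J|).+1 = (1 + #|above j| * r) + stair_size J j)%N.
  rewrite -cardC /stair_size mulnS mulnDr ![(r * _)%N]mulnC; have := r_gt0.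
  move: (_ * r)%N (#|below J j| * r)%N => a b; lia.
rewrite qnumD {1}/stair_poly (big_setD1 j Jj) /=.
set A := \prod_(_ in _) _; set B := \prod_(_ < _) _.
rewrite !mulrDr [A * (B * qnum _)]mulrA [_ * qnum _]mulrC; congr (_ + _).
by rewrite mulrA mulrCA; congr (_ * _); rewrite mulrC mulrA.
Qed.

(** Both claims go together in the induction: membership of the $g_{j'}$ for [J :\ j] yields
    [spansP_colon_add], which [tight_icolon] turns into tightness for [J]. *)
Lemma tight_colon J : (forall j, j \in J -> colon_ideal J (stair_gen J j)) /\
  tight (colon_ideal J) (stair_poly J).
Proof.
have [m] := ubnP #|J|; elim: m J => // m IHm J.
have [->|/set0Pn[j0 Jj0]] := eqVneq J set0.
  move=> _; split=> [j|]; first by rewrite inE.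
  rewrite /stair_poly big_set0 mul1r cards0 subn0 => d N.
  rewrite /colon_ideal /colon_poly big_set0 => sN; apply: (tight_coinv r_gt0); last first.
    by apply: spans_mono sN => p; rewrite /icolon mul1r.
  have := spansP_reduced prim_z char0 (hideal_coinv K n r) (coinv_psum K n r_gt0)
    (fun a => reduced_setT r a (hideal_coinv K n r)).
  by rewrite cardsT card_ord.
move=> ltJ; have [j Jj maxj] : exists2 j, j \in J & forall j', j' \in J -> (j' <= j)%N.
  by have [j Jj maxj] := @arg_maxnP _ j0 (mem J) val Jj0; exists j.
have [|gensJ' tightJ'] := IHm (J :\ j).
  by move: ltJ; rewrite (cardsD1 j) Jj.
have genj := stair_gen_colon_max Jj maxj gensJ'.
split=> [j' Jj'|].
  apply/(colon_poly_setD1 _ Jj).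
  have [->|nej'j] := eqVneq j' j; first exact: genj.
  apply: icolonW; first exact: hideal_colon.
  have J'j' : j' \in J :\ j by rewrite !inE nej'j.
  have := gensJ' j' J'j'; rewrite /stair_gen below_setD1 //.
  by rewrite ltn_neqAle nej'j maxj.
move=> d N sN; rewrite (stair_poly_setD1 Jj maxj) in tightJ'.
apply: (tight_icolon (hideal_colon _) (homog_colon_factor j) tightJ').
  exact: spansP_colon_add.
by apply: spans_mono sN => p /(colon_poly_setD1 _ Jj).
Qed.

Lemma stair_colon J p : stair_ideal J p -> colon_ideal J p.
Proof.
have hE := hideal_colon J; have [gensJ _] := tight_colon J.
apply: iadds_ind; first by move=> q Iq; apply: icolonW Iq; apply: hideal_coinv.
  exact: hidealD.
by move=> _ q /mapP[j Jj ->]; apply: hidealMr => //; apply: gensJ; rewrite -mem_enum.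
Qed.

(** A family spanning modulo [stair_ideal J] also spans modulo the larger [colon_ideal J], where its
    size is minimal, hence it is free there. *)
Lemma stair_basis J d : exists b : 'I_(((stair_poly J)`_d)%R) -> S,
  [/\ forall k, b k \is d.-homog,
      forall p, p \is d.-homog -> exists c : _ -> K,
        stair_ideal J (p - \sum_k c k *: b k) &
      forall c : _ -> K, coinv (colon_poly J * \sum_k c k *: b k) -> forall k, c k = 0].
Proof.
have [b [hb bP]] := spansP_stair_ideal J d; exists b; split=> // c.
apply: (tight_free (hideal_colon J) _ hb); first by case: (tight_colon J).
by move=> p /bP[a Ea]; exists a; apply: stair_colon.
Qed.

End Colon.

(** * Invariants in superspace *)

Section SuperMul.
Variables (K : fieldType) (n : nat).
Local Notation Om := (superspace K n).
Local Notation S := {mpoly K[n]}.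
Implicit Types (f g : Om) (p q : S) (A B C : {set 'I_n}) (i j : 'I_n).

Lemma superMl p f C : ((super_poly p : Om) * f) C = p * f C.
Proof. exact: super_polyMl. Qed.

Lemma superMr p f C : (f * (super_poly p : Om)) C = f C * p.
Proof. exact: super_polyMr. Qed.

Lemma superZ (c : K) f C : (c *: f) C = c *: f C.
Proof. exact: ffunE. Qed.

Lemma superD f g C : (f + g) C = f C + g C.
Proof. exact: ffunE. Qed.

Lemma superN f C : (- f) C = - f C.
Proof. exact: ffunE. Qed.

Lemma super_sum I (s : seq I) (P : pred I) (F : I -> Om) C :
  (\sum_(i <- s | P i) F i) C = \sum_(i <- s | P i) F i C.
Proof. exact: sum_ffunE. Qed.

Lemma super_polyC p f : (super_poly p : Om) * f = f * (super_poly p : Om).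
Proof. by apply/ffunP => C; rewrite superMl superMr mulrC. Qed.

Lemma super_polyM p q : super_poly (p * q) = (super_poly p : Om) * super_poly q.
Proof. by apply/ffunP => C; rewrite superMl !ffunE; case: eqP; rewrite ?mulr0. Qed.

Lemma super_polyD p q : super_poly (p + q) = (super_poly p : Om) + super_poly q.
Proof. by apply/ffunP => C; rewrite !ffunE; case: eqP; rewrite ?addr0. Qed.

Lemma super_polyZ (c : K) p : super_poly (c *: p) = c *: (super_poly p : Om).
Proof. by apply/ffunP => C; rewrite !ffunE; case: eqP; rewrite ?scaler0. Qed.

Lemma super_poly0 : super_poly 0 = 0 :> Om.
Proof. by apply/ffunP => C; rewrite !ffunE; case: eqP. Qed.

Lemma super_poly1 : super_poly 1 = 1 :> Om.
Proof. by []. Qed.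

Lemma super_poly_sum I (s : seq I) (P : pred I) (F : I -> S) :
  super_poly (\sum_(i <- s | P i) F i) = \sum_(i <- s | P i) (super_poly (F i) : Om).
Proof. by elim/big_rec2: _ => [|i _ y _ <-]; rewrite ?super_poly0 ?super_polyD. Qed.

Definition theta_sign i B : S := (-1) ^+ inversions [set i] B.

Lemma superM_theta i f C :
  (super_theta K i * f) C = if i \in C then theta_sign i (C :\ i) * f (C :\ i) else 0.
Proof.
transitivity (\sum_B theta_coef K [set i] B C * f B).
  rewrite [LHS]ffunE (bigD1 [set i]) //= [X in _ + X]big1 ?addr0 => [|A neA].
    by apply: eq_bigr => B _; rewrite ffunE eqxx mul1r.
  by apply: big1 => B _; rewrite ffunE (negPf neA) mul0r mulr0.
rewrite (bigD1 (C :\ i)) //= big1 ?addr0 => [|B neB].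
  rewrite /theta_coef disjoints1 setD11 /=; case Ci: (i \in C).
    by rewrite setD1K // eqxx.
  by case: eqP => [eqC|_]; rewrite ?mul0r //; rewrite -eqC setU11 in Ci.
rewrite /theta_coef disjoints1; case: ifP => [/andP[nBi /eqP eqC]|]; rewrite ?mul0r //.
by rewrite -eqC setU1K ?eqxx in neB.
Qed.

Lemma super_theta_sq i : super_theta K i * super_theta K i = 0 :> Om.
Proof.
apply/ffunP => C; rewrite superM_theta !ffunE; case: ifP => // Ci.
by case: eqP => [eqC|]; rewrite ?mulr0 //; have := setD11 i C; rewrite eqC set11.
Qed.

(** The letter [(m, b)] stands for $x^m \theta^b$, to be placed at any index. *)
Definition letter := (nat * bool)%type.

Definition super_letter (l : letter) i : Om :=
  super_poly ('X_i ^+ l.1) * (if l.2 then super_theta K i else 1).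

Lemma theta_swap (a b : bool) i j :
  (if a then super_theta K i else 1) * (if b then super_theta K j else 1) =
  (-1) ^+ (a && b) *:
    ((if b then super_theta K j else 1) * (if a then super_theta K i else 1)) :> Om.
Proof.
case: a; case: b; rewrite ?mulr1 ?mul1r ?expr0 ?scale1r //=.
by rewrite expr1 scaleN1r super_thetaN.
Qed.

Lemma super_letterC a b i j :
  super_letter a i * super_letter b j =
  (-1) ^+ (a.2 && b.2) *: (super_letter b j * super_letter a i).
Proof.
rewrite /super_letter; set p : Om := super_poly ('X_i ^+ _).
set q : Om := super_poly ('X_j ^+ _).
transitivity (p * q * ((if a.2 then super_theta K i else 1) *
                       (if b.2 then super_theta K j else 1))).
  by rewrite -!mulrA; congr (_ * _); rewrite !mulrA super_polyC.
rewrite theta_swap -super_scaleAr; congr (_ *: _).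
by rewrite [p * q]super_polyC -!mulrA; congr (_ * _); rewrite !mulrA super_polyC.
Qed.

Lemma super_letterM a b i : super_letter a i * super_letter b i =
  if a.2 && b.2 then 0 else super_letter ((a.1 + b.1)%N, a.2 || b.2) i.
Proof.
rewrite /super_letter /= exprD super_polyM; set p : Om := super_poly ('X_i ^+ a.1).
set q : Om := super_poly ('X_i ^+ b.1).
transitivity (p * q * ((if a.2 then super_theta K i else 1) *
                       (if b.2 then super_theta K i else 1))).
  by rewrite -!mulrA; congr (_ * _); rewrite !mulrA super_polyC.
by case: a.2; case: b.2; rewrite /= ?mulr1 // ?super_theta_sq ?mulr0 // mul1r.
Qed.

Lemma super_letter_coef l i C : super_letter l i C =
  if C == (if l.2 then [set i] else set0) then 'X_i ^+ l.1 else 0.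
Proof.
rewrite superMl; case: l => e [] /=; rewrite ffunE;
by case: eqP; rewrite ?mulr1 ?mulr0.
Qed.

End SuperMul.

(** * Polarization: symmetrized monomials and super power sums *)

Section PowerIdeal.
Variables (K : fieldType) (n r : nat).
Hypothesis char0 : [pchar K] =i pred0.
Local Notation Om := (superspace K n).
Local Notation S := {mpoly K[n]}.
Local Notation letters := (@super_letter K n).
Implicit Types (f g : Om) (A B C : {set 'I_n}) (i j : 'I_n) (l : letter).

(** The total degree is a positive multiple of [r]; these are the letters whose power sums are
    positive invariants. *)
Definition valid_letter l := exists k, (l.1 + l.2 = r * k.+1)%N.

Definition super_psum l : Om := \sum_i letters l i.

Inductive power_ideal : Om -> Prop :=
| power_ideal0 : power_ideal 0
| power_idealD f g : power_ideal f -> power_ideal g -> power_ideal (f + g)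
| power_ideal_psum l f : valid_letter l -> power_ideal (super_psum l * f).

Lemma power_idealMr f g : power_ideal f -> power_ideal (f * g).
Proof.
elim=> [|f1 f2 _ If1 _ If2|l f1 vl]; first by rewrite mul0r; apply: power_ideal0.
  by rewrite mulrDl; apply: power_idealD.
by rewrite -mulrA; apply: power_ideal_psum.
Qed.

Lemma power_idealZ (c : K) f : power_ideal f -> power_ideal (c *: f).
Proof. by rewrite -[c *: f]mulr1 -super_scaleAl super_scaleAr; apply: power_idealMr. Qed.

Lemma power_ideal_sum I (s : seq I) (P : pred I) (F : I -> Om) :
  (forall k, P k -> power_ideal (F k)) -> power_ideal (\sum_(k <- s | P k) F k).
Proof. by move=> PF; elim/big_ind: _; [apply: power_ideal0|apply: power_idealD|]. Qed.

(** Polynomials are central, and each $\theta_i$ commutes with a super power sum up to sign, so the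
    right ideal is two-sided. *)
Lemma power_idealMl f g : power_ideal f -> power_ideal (g * f).
Proof.
move=> If; rewrite (super_decomp g) mulr_suml; apply: power_ideal_sum => A _.
rewrite -mulrA super_polyC; apply: power_idealMr.
elim: (enum A) => [|i s IHs]; first by rewrite big_nil mul1r.
rewrite big_cons -mulrA; move: (_ * f) IHs => h.
elim=> [|f1 f2 _ If1 _ If2|l f1 vl]; first by rewrite mulr0; apply: power_ideal0.
  by rewrite mulrDr; apply: power_idealD.
have -> : super_theta K i = letters (0%N, true) i.
  by rewrite /super_letter expr0 super_poly1 mul1r.
rewrite mulrA /super_psum mulr_sumr.
under eq_bigr => j _ do rewrite super_letterC.
rewrite -scaler_sumr -mulr_suml -super_scaleAl -mulrA.
exact/power_idealZ/power_ideal_psum.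
Qed.

(** Move [a] up to the letter at [s], collecting signs, and multiply the two: the result is 0 if
    both contain $\theta$, and otherwise again valid. That [c] and [m'] do not depend on [w] allows
    summation over permutations. *)
Lemma merge_letter a (m : 'I_n -> letter) (s : 'I_n) ts :
    valid_letter a -> {in ts, forall t, valid_letter (m t)} -> uniq ts -> s \in ts ->
  exists (c : K) (m' : 'I_n -> letter), {in ts, forall t, valid_letter (m' t)} /\
    forall w : 'I_n -> 'I_n, letters a (w s) * \prod_(t <- ts) letters (m t) (w t) =
      c *: \prod_(t <- ts) letters (m' t) (w t).
Proof.
move=> va; elim: ts => // t ts IHts vm /andP[nts_t uts] ts_s.
have eq_ts (F F' : 'I_n -> Om) : (forall u, u \in ts -> F u = F' u) ->
    \prod_(u <- ts) F u = \prod_(u <- ts) F' u.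
  by move=> eqF; rewrite big_seq [RHS]big_seq; apply: eq_bigr.
have neq_t u : u \in ts -> (u == t) = false.
  by move=> ts_u; apply: contraNF nts_t => /eqP <-.
move: ts_s; rewrite inE; have [-> _|nest /= ts_s] := eqVneq s t.
  case ab: (a.2 && (m t).2).
    exists 0, m; split=> // w; rewrite big_cons mulrA super_letterM ab mul0r scale0r //.
  pose b : letter := ((a.1 + (m t).1)%N, a.2 || (m t).2).
  exists 1, (fun u => if u == t then b else m u); split=> [u|w].
    rewrite inE; case: eqP => [_ _|_ /= ts_u]; last by apply: vm; rewrite inE ts_u orbT.
    have [k1 eq1] := va; have [k2 eq2] := vm t (mem_head _ _).
    exists (k1 + k2.+1)%N; rewrite -addSn mulnDr -eq1 -eq2 /b /=.
    by move: ab; case: a.2; case: (m t).2 => // _; lia.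
  rewrite scale1r !big_cons eqxx mulrA super_letterM ab; congr (_ * _).
  by apply: eq_ts => u ts_u; rewrite neq_t.
have [|c [m' [vm' m'P]]] := IHts _ uts ts_s.
  by move=> u ts_u; apply: vm; rewrite inE ts_u orbT.
exists ((-1) ^+ (a.2 && (m t).2) * c), (fun u => if u == t then m t else m' u); split=> [u|w].
  rewrite inE; case: eqP => [_ _|_ /= ts_u]; last exact: vm'.
  by apply: vm; apply: mem_head.
rewrite !big_cons eqxx mulrA super_letterC -scalerAl -mulrA m'P -scalerAr scalerA.
by congr (_ *: (_ * _)); apply: eq_ts => u ts_u; rewrite neq_t.
Qed.

Definition sym_letters (ts : seq 'I_n) (m : 'I_n -> letter) : Om :=
  \sum_(w : 'S_n) \prod_(t <- ts) letters (m t) (w t).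

(* Multiplying the power sum of the first letter into the symmetrized product of
   the others yields positive multiples of the symmetrized product, plus shorter
   ones in which two letters have been merged. *)
Lemma power_ideal_sym ts m : uniq ts -> ts != [::] ->
  {in ts, forall t, valid_letter (m t)} -> power_ideal (sym_letters ts m).
Proof.
have [k] := ubnP (size ts); elim: k ts m => // k IHk [|t ts] m //= lt_ts.
case/andP=> nts_t uts _ vm; have vt := vm t (mem_head _ _).
have vm' : {in ts, forall u, valid_letter (m u)}.
  by move=> u ts_u; apply: vm; rewrite inE ts_u orbT.
pose F u : Om := \sum_(w : 'S_n) letters (m t) (w u) * \prod_(v <- ts) letters (m v) (w v).
have sumF : \sum_u F u = super_psum (m t) * sym_letters ts m.
  rewrite exchange_big /sym_letters mulr_sumr; apply: eq_bigr => w _ /=.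
  have -> : super_psum (m t) = \sum_u letters (m t) (w u).
    exact: reindex_inj (@perm_inj _ w).
  by rewrite mulr_suml.
have F_in u : u \in ts -> power_ideal (F u).
  move=> ts_u; have [c [m' [vm'' m'P]]] := merge_letter vt vm' uts ts_u.
  have -> : F u = c *: sym_letters ts m'.
    by rewrite scaler_sumr; apply: eq_bigr => w _; apply: m'P.
  apply/power_idealZ/IHk => //.
  by case: (ts) ts_u.
(* Composing [w] with the transposition of [t] and [u] moves the first letter to [t] without
   affecting the indices in [ts]. *)
have F_out u : u \notin ts -> F u = sym_letters (t :: ts) m.
  move=> nts_u; rewrite /F (reindex_inj (mulgI (tperm t u))); apply: eq_bigr => w _ /=.
  rewrite big_cons permM tpermR; congr (_ * _).
  rewrite big_seq [RHS]big_seq; apply: eq_bigr => v ts_v; rewrite permM tpermD //.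
    by apply: contraNneq nts_t => ->.
  by apply: contraNneq nts_u => ->.
have := power_ideal_psum (sym_letters ts m) vt.
rewrite -sumF (bigID (mem ts)) /= => Isum.
have : power_ideal (\sum_(u | u \notin ts) F u).
  rewrite -[X in power_ideal X](addKr (\sum_(u in ts) F u)); apply: power_idealD => //.
  by rewrite -scaleN1r; apply/power_idealZ/power_ideal_sum.
rewrite (eq_bigr _ F_out) sumr_const; set X := sym_letters _ _; set N := #|_|.
have N_gt0 : (0 < N)%N by apply/card_gt0P; exists t.
have nzN : N%:R != 0 :> K by rewrite ((pcharf0P K).1 char0) -lt0n.
by rewrite -scaler_nat => /(power_idealZ N%:R^-1); rewrite scalerA mulVf ?scale1r.
Qed.

End PowerIdeal.

(** * The action of monomial matrices *)

Section MonomialAction.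
Variables (K : fieldType) (n : nat).
Local Notation Om := (superspace K n).
Local Notation S := {mpoly K[n]}.
Local Notation letters := (@super_letter K n).
Implicit Types (f h : Om) (A B C : {set 'I_n}) (i j : 'I_n) (l : letter) (g : 'M[K]_n).

Lemma prod_scale (s : seq 'I_n) (c : 'I_n -> K) (F : 'I_n -> Om) :
  \prod_(i <- s) (c i *: F i) = (\prod_(i <- s) c i) *: \prod_(i <- s) F i.
Proof.
elim: s => [|i s IHs]; first by rewrite !big_nil scale1r.
by rewrite !big_cons IHs -super_scaleAl -super_scaleAr scalerA.
Qed.

Definition letter_of (m : 'X_{1..n}) A i : letter := (m i, i \in A).

(** Since polynomials are central, each $\theta$ can be joined to the power of $x$ with the same
    index. *)
Lemma prod_letters (m : 'X_{1..n}) A (d : 'I_n -> K) (s : 'I_n -> 'I_n) :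
  super_poly (\prod_i (d i *: 'X_(s i)) ^+ m i) *
    \prod_(i <- enum A) (d i *: super_theta K (s i)) =
  (\prod_i d i ^+ (m i + (i \in A))) *:
    \prod_(i <- enum 'I_n) letters (letter_of m A i) (s i).
Proof.
have eS (G : 'I_n -> S) : \prod_i G i = \prod_(i <- enum 'I_n) G i by rewrite big_enum.
have eK (G : 'I_n -> K) : \prod_i G i = \prod_(i <- enum 'I_n) G i by rewrite big_enum.
rewrite eS eK.
have -> : enum A = [seq i <- enum 'I_n | i \in A] by rewrite enumT.
rewrite -prod_scale; elim: (enum 'I_n) => [|i ts IHts] /=.
  by rewrite !big_nil super_poly1 mulr1.
rewrite !big_cons -IHts super_polyM.
set P : Om := super_poly (\prod_(j <- ts) _); set T : Om := \prod_(j <- filter _ _) _.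
have -> : \prod_(j <- if i \in A then i :: [seq j <- ts | j \in A] else [seq j <- ts | j \in A])
    (d j *: super_theta K (s j)) = (if i \in A then d i *: super_theta K (s i) else 1) * T.
  by case: ifP; rewrite ?big_cons ?mul1r.
have -> : d i ^+ (m i + (i \in A)) *: letters (letter_of m A i) (s i) =
    (super_poly ((d i *: 'X_(s i)) ^+ m i) : Om) *
      (if i \in A then d i *: super_theta K (s i) else 1).
  rewrite /super_letter /= exprZn super_polyZ -super_scaleAl.
  by case: ifP; rewrite ?addn0 // addn1 exprSr -super_scaleAr scalerA.
by rewrite -!mulrA; congr (_ * _); rewrite !mulrA [P * _]super_polyC.
Qed.

Lemma super_actD g f h : super_act g (f + h) = super_act g f + super_act g h.
Proof.
rewrite /super_act -big_split; apply: eq_bigr => A _ /=.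
by rewrite ffunE comp_mpolyD super_polyD mulrDl.
Qed.

Lemma super_act0 g : super_act g 0 = 0.
Proof.
by rewrite /super_act big1 // => A _; rewrite ffunE comp_mpoly0 super_poly0 mul0r.
Qed.

Section Monomial.
Variables (g : 'M[K]_n) (d : 'I_n -> K) (s : 'I_n -> 'I_n).
Hypothesis gE : forall i j, invmx g i j = d i *+ (s i == j).

Lemma act_x_monomial i : tnth (act_x g) i = d i *: 'X_(s i).
Proof.
rewrite tnth_mktuple (bigD1 (s i)) //= big1 ?addr0 => [|j neij]; rewrite gE.
  by rewrite eqxx.
by rewrite eq_sym (negPf neij) scale0r.
Qed.

Lemma act_theta_monomial i : act_theta g i = d i *: super_theta K (s i).
Proof.
rewrite /act_theta (bigD1 (s i)) //= big1 ?addr0 => [|j neij]; rewrite gE.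
  by rewrite eqxx.
by rewrite eq_sym (negPf neij) scale0r.
Qed.

Lemma super_act_letter l i :
  super_act g (letters l i) = d i ^+ (l.1 + l.2) *: letters l (s i).
Proof.
set B := if l.2 then [set i] else set0.
rewrite /super_act (bigD1 B) //= [X in _ + X]big1 ?addr0 => [|A neA]; last first.
  by rewrite super_letter_coef (negPf neA) comp_mpoly0 super_poly0 mul0r.
rewrite super_letter_coef eqxx rmorphXn /= comp_mpolyXU -tnth_nth act_x_monomial exprZn.
rewrite super_polyZ -super_scaleAl /super_letter /B.
case: l.2; rewrite ?enum_set0 ?big_nil ?addn0 //.
by rewrite enum_set1 big_seq1 act_theta_monomial -super_scaleAr scalerA addn1 exprSr.
Qed.

Lemma super_act_monomial f : super_act g f = \sum_A \sum_(m <- msupp (f A))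
  ((f A)@_m * \prod_i d i ^+ (m i + (i \in A))) *:
    \prod_(i <- enum 'I_n) letters (letter_of m A i) (s i).
Proof.
apply: eq_bigr => A _; rewrite comp_mpolyEX super_poly_sum mulr_suml.
have -> : \prod_(i <- enum A) act_theta g i = \prod_(i <- enum A) (d i *: super_theta K (s i)).
  by apply: eq_bigr => i _; rewrite act_theta_monomial.
apply: eq_bigr => m _.
have -> : 'X_[m] \mPo act_x g = \prod_i (d i *: 'X_(s i)) ^+ m i.
  by rewrite comp_mpolyX; apply: eq_bigr => i _; rewrite act_x_monomial.
by rewrite super_polyZ -super_scaleAl prod_letters scalerA.
Qed.

End Monomial.

Lemma invmx_eq g g' : g' *m g = 1%:M -> invmx g = g'.
Proof. by move=> gg'; have [_ ug] := mulmx1_unit gg'; rewrite -[LHS]mul1mx -gg' mulmxK. Qed.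

Lemma invmx_perm (w : 'S_n) i j : invmx (perm_mx w)^T i j = 1 *+ (w i == j) :> K.
Proof.
rewrite (@invmx_eq _ (perm_mx w)); first by rewrite !mxE.
by rewrite tr_perm_mx -perm_mxM mulgV perm_mx1.
Qed.

Lemma invmx_diag (e : 'I_n -> K) i j : (forall k, e k != 0) ->
  invmx (diag_mx (\row_k e k)) i j = (e i)^-1 *+ (i == j).
Proof.
move=> nze; rewrite (@invmx_eq _ (diag_mx (\row_k (e k)^-1))); first by rewrite !mxE.
rewrite mulmx_diag; apply/matrixP => k l; rewrite !mxE.
by rewrite mulVf.
Qed.

Lemma in_wreath_perm r (w : 'S_n) : in_wreath r (perm_mx w : 'M[K]_n)^T.
Proof.
have wE i j : (perm_mx w)^T i j = (w j == i)%:R :> K by rewrite !mxE.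
have nzE (b : bool) : (b%:R != 0 :> K) = b by case: b; rewrite ?oner_eq0 ?eqxx.
split=> [i|j|i j].
- exists (w^-1%g i); split=> [|j]; rewrite wE nzE ?permKV //.
  by move/eqP <-; rewrite permK.
- exists (w j); split=> [|i]; rewrite wE nzE //.
  by move/eqP.
by rewrite wE nzE => ->; rewrite expr1n.
Qed.

Lemma in_wreath_diag r (e : 'I_n -> K) : (0 < r)%N -> (forall k, e k ^+ r = 1) ->
  in_wreath r (diag_mx (\row_k e k)).
Proof.
move=> r_gt0 e1; have nze k : e k != 0.
  by apply/eqP => e0; have /eqP := e1 k; rewrite e0 expr0n gtn_eqF // eq_sym oner_eq0.
have eE i j : diag_mx (\row_k e k) i j = e i *+ (i == j) by rewrite !mxE.
have nzE (b : bool) i : (e i *+ b != 0) = b by case: b; rewrite ?nze ?eqxx.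
split=> [i|j|i j].
- exists i; split=> [|j]; rewrite eE nzE //.
  by move/eqP.
- exists j; split=> [|i]; rewrite eE nzE //.
  by move/eqP.
by rewrite eE nzE => ->; rewrite mulr1n e1.
Qed.

(** Here [s i] is the row of the nonzero entry in column [i], and [d i] is the inverse of that
    entry. *)
Lemma in_wreath_monomial r g : in_wreath r g ->
  exists (d : 'I_n -> K) (s : 'I_n -> 'I_n),
    [/\ injective s, forall i, d i ^+ r = 1 & forall i j, invmx g i j = d i *+ (s i == j)].
Proof.
case=> row_g col_g root_g.
have /fin_all_exists[s sP] j : exists i, g i j != 0 /\ forall i', g i' j != 0 -> i = i'.
  by have [i [nz uniq_i]] := col_g j; exists i.
exists (fun i => (g (s i) i)^-1), s; split=> [i1 i2 eqs|i|i j].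
- have [j [_ uniq_j]] := row_g (s i1).
  have [nz1 _] := sP i1; have [nz2 _] := sP i2.
  by transitivity j; [apply/esym/uniq_j|apply: uniq_j; rewrite eqs].
- by rewrite exprVn root_g ?invr1 //; case: (sP i).
rewrite (@invmx_eq _ (\matrix_(k, l) ((g (s k) k)^-1 *+ (s k == l)))); first by rewrite mxE.
apply/matrixP => k l; rewrite !mxE (bigD1 (s k)) //= big1 ?addr0 => [|u neuk].
  rewrite mxE eqxx; have [nzk _] := sP k; have [<-|nekl] := eqVneq k l; first exact: mulVf.
  apply/eqP; rewrite mulf_eq0 invr_eq0 (negPf nzk) /=; apply: contraNT nekl => nzl.
  have [v [_ uniq_v]] := row_g (s k).
  by apply/eqP; transitivity v; [apply/esym/uniq_v|apply: uniq_v].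
by rewrite mxE eq_sym (negPf neuk) mul0r.
Qed.

End MonomialAction.

(** * Positive invariants and super power sums *)

Section Invariants.
Variables (K : fieldType) (n r : nat) (z : K).
Hypothesis prim_z : r.-primitive_root z.
Hypothesis char0 : [pchar K] =i pred0.
Local Notation Om := (superspace K n).
Local Notation S := {mpoly K[n]}.
Local Notation letters := (@super_letter K n).
Implicit Types (f h : Om) (A B C : {set 'I_n}) (i j : 'I_n) (l : letter).

Let r_gt0 : (0 < r)%N := prim_order_gt0 prim_z.

Lemma positive_invariant_psum l : valid_letter r l -> positive_invariant r (super_psum K n l).
Proof.
case=> k eqk; split=> [g /in_wreath_monomial[d [s [inj_s d1 gE]]]|].
  rewrite /super_psum (big_morph _ (super_actD g) (super_act0 g)).
  under eq_bigr => i _ do rewrite (super_act_letter gE) eqk exprM d1 expr1n scale1r.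
  by rewrite [RHS](reindex_inj inj_s).
rewrite /constant_term /super_psum sum_ffunE raddf_sum /= big1 // => i _.
rewrite super_letter_coef; move: eqk; case: l => e [] /=.
  move=> _; case: eqP => [/setP/(_ i)|]; last by rewrite mcoeff0.
  by rewrite !inE eqxx.
rewrite eqxx addn0 => ->; rewrite mcoeffXn; case: eqP => // /(congr1 mdeg).
by rewrite mdegMn mdeg1 mdeg0 mul1n mulnS; have := r_gt0; lia.
Qed.

Lemma invariant_dvdn f A (m : 'X_{1..n}) i : super_invariant r f -> (f A)@_m != 0 ->
  (r %| m i + (i \in A))%N.
Proof.
(* The diagonal matrix with $z^{-1}$ at [i] multiplies the coefficient of $x^m \theta_A$ by $z$ to
   the power [m i + (i \in A)]. *)
move=> inv_f nzf; pose e j := if j == i then z^-1 else 1.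
have nzz : z != 0.
  apply: contra_eq_neq (prim_expr_order prim_z) => ->.
  by rewrite expr0n gtn_eqF // eq_sym oner_eq0.
have e1 j : e j ^+ r = 1.
  by rewrite /e; case: eqP; rewrite ?expr1n // exprVn (prim_expr_order prim_z) invr1.
have nze j : e j != 0 by rewrite /e; case: (j == i); rewrite ?invr_eq0 ?oner_eq0.
have := inv_f _ (in_wreath_diag r_gt0 e1).
have gE j k : invmx (diag_mx (\row_k e k)) j k = (e j)^-1 *+ (id j == k).
  exact: invmx_diag.
rewrite (super_act_monomial gE) => /ffunP/(_ A)/(congr1 (mcoeff m)).
have monE B (u : 'X_{1..n}) :
    \prod_(j <- enum 'I_n) letters (letter_of u B j) j = super_poly 'X_[u] * super_thetas K B.
  have d1 : \prod_i (1 : K) ^+ (u i + (i \in B)) = 1.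
    by rewrite big1 // => j _; rewrite expr1n.
  rewrite -[LHS]scale1r -d1; apply: etrans (esym (prod_letters u B (fun=> 1) id)) _.
  rewrite mpolyXE_id -prod_super_theta.
  by congr (super_poly _ * _); apply: eq_bigr => j _; rewrite scale1r.
rewrite super_sum (bigD1 A) //= [X in _ + X]big1 ?addr0 => [|B neB]; last first.
  rewrite super_sum big1 // => u _; rewrite superZ monE superMl ffunE eq_sym (negPf neB).
  by rewrite mulr0 scaler0.
rewrite super_sum raddf_sum /= (bigD1_seq m) ?msupp_uniq ?mcoeff_msupp //=.
rewrite [X in _ + X]big1 ?addr0 => [|u neu]; rewrite superZ monE superMl ffunE eqxx mulr1 mcoeffZ mcoeffX;
  last by rewrite (negPf neu) mulr0.
rewrite eqxx mulr1 -[RHS]mulr1 => /(mulfI nzf); rewrite (bigD1 i) //= big1 => [|j neji].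
  by rewrite /e eqxx invrK mulr1 => /eqP; rewrite -(prim_order_dvd prim_z).
by rewrite /e (negPf neji) invr1 expr1n.
Qed.

(** Averaging over permutations writes [f] through symmetrized monomials. By [invariant_dvdn] each
    letter is trivial or valid; the trivial ones are dropped, and some letter remains because the
    constant term is zero. *)
Lemma positive_invariant_power f : positive_invariant r f -> power_ideal r f.
Proof.
case=> inv_f f0; pose F A (m : 'X_{1..n}) : Om :=
  \sum_(w : 'S_n) \prod_(i <- enum 'I_n) letters (letter_of m A i) (w i).
have sumF : f *+ #|{: 'S_n}| = \sum_A \sum_(m <- msupp (f A)) (f A)@_m *: F A m.
  transitivity (\sum_(w : 'S_n) \sum_A \sum_(m <- msupp (f A))
      (f A)@_m *: \prod_(i <- enum 'I_n) letters (letter_of m A i) (w i)).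
    rewrite -sumr_const; apply: eq_bigr => w _.
    rewrite -[LHS](inv_f _ (in_wreath_perm K r w)) (super_act_monomial (invmx_perm K w)).
    apply: eq_bigr => A _; apply: eq_bigr => m _; rewrite big1 ?mulr1 // => i _.
    by rewrite expr1n.
  rewrite exchange_big; apply: eq_bigr => A _ /=.
  rewrite exchange_big; apply: eq_bigr => m _ /=.
  by rewrite /F scaler_sumr.
have nzN : #|{: 'S_n}|%:R != 0 :> K.
  by rewrite ((pcharf0P K).1 char0) -lt0n; apply/card_gt0P; exists 1%g.
have -> : f = #|{: 'S_n}|%:R^-1 *: (f *+ #|{: 'S_n}|).
  by rewrite -scaler_nat scalerA mulVf ?scale1r.
rewrite sumF; apply: power_idealZ; apply: power_ideal_sum => A _.
rewrite big_seq; apply: power_ideal_sum => m; rewrite mcoeff_msupp => nzm.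
apply: power_idealZ; pose ts := [seq i <- enum 'I_n | (m i + (i \in A) != 0)%N].
have -> : F A m = sym_letters K ts (letter_of m A).
  apply: eq_bigr => w _; rewrite [RHS]big_filter; apply/esym/big_rmcond => i.
  rewrite negbK addn_eq0 => /andP[/eqP m0 /eqP A0].
  rewrite /super_letter /= m0 expr0 super_poly1 mul1r.
  by move: A0; case: (i \in A).
apply: (power_ideal_sym char0) => [||i].
- exact/filter_uniq/enum_uniq.
- apply/negP => /eqP ts0; have mA i : (m i == 0)%N && (i \notin A).
    have : i \notin ts by rewrite ts0.
    rewrite mem_filter mem_enum andbT negbK addn_eq0 => /andP[-> /eqP].
    by case: (i \in A).
  have A0 : A = set0 by apply/setP => i; rewrite inE; case/andP: (mA i) => _ /negPf.
  have m0 : m = 0%MM by apply/mnmP => i; rewrite mnm0E; case/andP: (mA i) => /eqP.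
  by move: nzm; rewrite A0 m0 [X in X != _]f0 eqxx.
rewrite mem_filter => /andP[nz _].
have /dvdnP[k eqk] := invariant_dvdn i inv_f nzm; rewrite /valid_letter /= eqk.
by move: nz; rewrite eqk; case: k {eqk} => // k _; exists k; rewrite mulnC.
Qed.

End Invariants.

(** * Contractions *)

Section Contraction.
Variables (K : fieldType) (n : nat).
Local Notation Om := (superspace K n).
Local Notation S := {mpoly K[n]}.
Local Notation tsign := (@theta_sign K n).
Implicit Types (f g : Om) (p q : S) (A B C : {set 'I_n}) (i j k : 'I_n) (d : 'I_n -> S).

Lemma theta_sign_sq i B : tsign i B * tsign i B = 1.
Proof. by rewrite -expr2 sqrr_sign. Qed.

Lemma inversions_set1 i k : inversions [set i] [set k] = (k < i)%N.
Proof.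
rewrite /inversions; case: ltnP => [lt_ki|le_ik].
  transitivity #|[set (i, k)]|; last by rewrite cards1.
  apply: eq_card => -[a b]; rewrite !inE /= xpair_eqE.
  by case: eqP => // ->; case: eqP => // ->; rewrite lt_ki.
apply: eq_card0 => -[a b]; rewrite !inE /=; apply/negP.
by case/andP => /andP[/eqP-> /eqP->]; rewrite ltnNge le_ik.
Qed.

Lemma theta_signU1 i k B : k \notin B -> tsign i (k |: B) = (-1) ^+ (k < i)%N * tsign i B.
Proof.
by move=> nBk; rewrite /theta_sign inversionsUr ?disjoints1 // inversions_set1 exprD.
Qed.

Lemma theta_sign_swap i k B : i != k -> i \notin B -> k \notin B ->
  tsign i (k |: B) * tsign k (i |: B) = - (tsign k B * tsign i B).
Proof.
move=> neik nBi nBk; rewrite !theta_signU1 // mulrACA [tsign i B * _]mulrC.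
move: neik; rewrite neq_ltn; case: ltngtP => //= _ _.
  by rewrite expr1 expr0 mul1r mulN1r.
by rewrite expr1 expr0 mulr1 mulN1r.
Qed.

(** Interior multiplication: the antiderivation over $S$ sending $\theta_i$ to [d i], as
    [contract_theta] confirms. *)
Definition contract d f : Om :=
  [ffun B : {set 'I_n} => \sum_(i | i \notin B) tsign i B * (d i * f (i |: B))].

Lemma contractE d f B :
  contract d f B = \sum_(i | i \notin B) tsign i B * (d i * f (i |: B)).
Proof. exact: ffunE. Qed.

Lemma contractD d f g : contract d (f + g) = contract d f + contract d g.
Proof.
apply/ffunP => B; rewrite !ffunE -big_split; apply: eq_bigr => i _ /=.
by rewrite ffunE !mulrDr.
Qed.

Lemma contract0 d : contract d 0 = 0.
Proof. by apply/ffunP => B; rewrite !ffunE big1 // => i _; rewrite ffunE !mulr0. Qed.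

Lemma contract_poly d p f : contract d (super_poly p * f) = super_poly p * contract d f.
Proof.
apply/ffunP => B; rewrite superMl !ffunE mulr_sumr; apply: eq_bigr => i _.
by rewrite superMl; ring.
Qed.

Lemma contractN d f : contract d (- f) = - contract d f.
Proof.
have <- : super_poly (-1) * f = - f by apply/ffunP => B; rewrite superMl ffunE mulN1r.
by rewrite contract_poly; apply/ffunP => B; rewrite superMl !ffunE mulN1r.
Qed.

Lemma contract_theta d k f :
  contract d (super_theta K k * f) = super_poly (d k) * f - super_theta K k * contract d f.
Proof.
apply/ffunP => B; rewrite superD superMl superN superM_theta [LHS]contractE.
case Bk: (k \in B); last first.
  rewrite subr0 (bigD1 k) ?Bk //= big1 ?addr0 => [|i /andP[nBi neik]].
    rewrite superM_theta setU11 setU1K ?Bk //.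
    transitivity (tsign k B * tsign k B * (d k * f B)); first by ring.
    by rewrite theta_sign_sq mul1r.
  by rewrite superM_theta !inE Bk eq_sym (negPf neik) !mulr0.
rewrite contractE [X in _ - _ * X](bigD1 k) ?setD11 //= setD1K // mulrDr opprD addrA.
rewrite [tsign _ _ * (tsign _ _ * _)]mulrA theta_sign_sq mul1r subrr add0r.
rewrite mulr_sumr -sumrN; apply: eq_big => [i|i nBi].
  by rewrite !inE negb_and negbK; case: eqP => [->|]; rewrite ?Bk // andbT.
have neik : i != k by apply: contraNneq nBi => ->.
have eqB : (i |: B) :\ k = i |: (B :\ k).
  by apply/setP => u; rewrite !inE; case: (eqVneq u i) => // ->; rewrite neik.
rewrite superM_theta inE Bk orbT eqB; set B0 := B :\ k.
have nB0i : i \notin B0 by rewrite !inE negb_and nBi orbT.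
have nB0k : k \notin B0 by rewrite !inE eqxx.
have -> : tsign i B = tsign i (k |: B0) by rewrite setD1K.
have := theta_sign_swap neik nB0i nB0k; move: (tsign i _) (tsign k _) => s1 s2 E.
transitivity (s1 * s2 * (d i * f (i |: B0))); first by ring.
by rewrite E; ring.
Qed.

Fixpoint contracts (e : 'I_n -> 'I_n -> S) (js : seq 'I_n) f : S :=
  if js is j :: js' then contracts e js' (contract (e j) f) else f set0.

Lemma contractsD e js f g : contracts e js (f + g) = contracts e js f + contracts e js g.
Proof.
by elim: js f g => [|j js IHjs] f g /=; rewrite ?contractD ?IHjs // ffunE.
Qed.

Lemma contractsN e js f : contracts e js (- f) = - contracts e js f.
Proof. by elim: js f => [|j js IHjs] f /=; rewrite ?contractN ?IHjs // ffunE. Qed.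

Lemma contracts0 e js : contracts e js 0 = 0.
Proof. by elim: js => [|j js IHjs] /=; rewrite ?contract0 // ffunE. Qed.

Lemma contracts_poly e js p f : contracts e js (super_poly p * f) = p * contracts e js f.
Proof. by elim: js f => [|j js IHjs] f /=; rewrite ?contract_poly ?IHjs // superMl. Qed.

(* If e j i = 0 for i > j, contracting theta_B by the list js replaces the
   elements of B by smaller or equal ones, so only B = js survives among the B of
   weight at least that of js. *)
Lemma contracts_triangular (e : 'I_n -> 'I_n -> S) (js : seq 'I_n) f :
    (forall i j, (j < i)%N -> e j i = 0) -> uniq js ->
    (forall B, f B != 0 -> (\sum_(j <- js) (j : nat) <= \sum_(i in B) (i : nat))%N) ->
  exists s : nat, contracts e js f =
    (-1) ^+ s * ((\prod_(j <- js) e j j) * f [set i in js]).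
Proof.
move=> e0; elim: js f => [|j js IHjs] f /= ujs fP.
  exists 0%N; rewrite big_nil expr0 !mul1r.
  by have -> : [set i in [::]] = set0 :> {set 'I_n} by apply/setP => i; rewrite !inE.
case/andP: ujs => njs_j ujs.
have sumU i B : i \notin B ->
    (\sum_(k in i |: B) (k : nat) = i + \sum_(k in B) (k : nat))%N.
  by move=> nBi; rewrite big_setU1.
have [|s ->] := IHjs (contract (e j) f) ujs.
  move=> B; rewrite contractE; apply: contraR; rewrite -ltnNge => ltB.
  apply/eqP/big1 => i nBi; case: (ltnP j i) => [lt_ji|le_ij].
    by rewrite e0 // mul0r mulr0.
  have [->|/fP] := eqVneq (f (i |: B)) 0; first by rewrite !mulr0.
  by rewrite big_cons sumU //; lia.
rewrite contractE (bigD1 j) ?inE //= [X in _ + X]big1 => [|i /andP[njs_i neij]].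
  rewrite addr0.
  exists (s + inversions [set j] [set i in js])%N.
  have -> : [set i in j :: js] = j |: [set i in js] by apply/setP => i; rewrite !inE.
  by rewrite big_cons exprD /theta_sign; ring.
case: (ltnP j i) => [lt_ji|le_ij]; first by rewrite e0 // mul0r mulr0.
have [->|/fP] := eqVneq (f (i |: [set k in js])) 0; first by rewrite !mulr0.
have sumjs : (\sum_(k in [set i in js]) (k : nat) = \sum_(k <- js) (k : nat))%N.
  by rewrite big_uniq //; apply: eq_bigl => k; rewrite inE.
rewrite big_cons sumU // sumjs leq_add2r => le_ji.
by case/eqP: neij; apply/val_inj/eqP; rewrite eqn_leq le_ij.
Qed.

End Contraction.

(** * Contractions map the power ideal into the coinvariant ideal *)

Section ContractPower.
Variables (K : fieldType) (n r : nat).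
Hypothesis r_gt0 : (0 < r)%N.
Local Notation Om := (superspace K n).
Local Notation S := {mpoly K[n]}.
Local Notation powx := (@powx K n r).
Local Notation coinv := (@coinv_ideal K n r).
Implicit Types (f g : Om) (i j : 'I_n) (l : letter).

(** Zero for [i > j], and equal to [colon_factor j] for [i = j]: the triangular shape asked for by
    [contracts_triangular]. *)
Definition contract_coef j i : S := 'X_i * \prod_(u in above j) (powx i - powx u).

Lemma contract_coef_gt i j : (j < i)%N -> contract_coef j i = 0.
Proof.
by move=> lt_ji; rewrite /contract_coef (bigD1 i) ?inE //= subrr mul0r mulr0.
Qed.

Lemma super_psum_even k : super_psum K n ((r * k)%N, false) = super_poly (psum K n r k).
Proof.
rewrite /psum super_poly_sum; apply: eq_bigr => i _.
by rewrite /super_letter mulr1 /= exprM.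
Qed.

Lemma contract_psum_odd (d : 'I_n -> S) m f :
  contract d (super_psum K n (m, true) * f) =
  super_poly (\sum_i 'X_i ^+ m * d i) * f - super_psum K n (m, true) * contract d f.
Proof.
rewrite /super_psum !mulr_suml super_poly_sum mulr_suml -sumrB.
have cD := big_morph (contract d) (contractD d) (contract0 d).
rewrite cD; apply: eq_bigr => i _.
rewrite /super_letter /= -!mulrA contract_poly contract_theta mulrBr.
by rewrite [X in X - _]mulrA -super_polyM mulrA.
Qed.

Lemma coinv_contract_coef j k m : (m + 1 = r * k.+1)%N ->
  coinv (\sum_i 'X_i ^+ m * contract_coef j i).
Proof.
move=> eqm; have hE := hideal_coinv K n r.
(* Since $x_i^{m+1} = y_i^{k+1}$, one factor $y_i$ stays in front and the others go into [P]. *)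
pose P : {poly S} := 'X^k * vpoly K r (above j).
suff -> : \sum_i 'X_i ^+ m * contract_coef j i = \sum_i powx i * P.[powx i].
  by apply: hideal_psum_horner => // i _; apply: coinv_psum.
apply: eq_bigr => i _; rewrite /contract_coef /P hornerM hornerXn horner_vpoly !mulrA.
by rewrite -exprSr -addn1 eqm exprM exprS.
Qed.

(** A contraction either hits an odd power sum, giving an element of [coinv], or passes it with a
    sign. An odd power sum never contracted contributes nothing to the coefficient at [set0]. *)
Lemma power_ideal_contracts js f : power_ideal r f ->
  coinv (contracts contract_coef js f).
Proof.
have hE := hideal_coinv K n r.
elim=> [|f1 f2 _ If1 _ If2|[m b] g [k /= eqm]].
- by rewrite contracts0; apply: hideal0.
- by rewrite contractsD; apply: hidealD.
move: eqm; case: b => eqm; last first.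
  rewrite addn0 in eqm; rewrite eqm super_psum_even contracts_poly.
  by apply: hidealMr => //; apply: coinv_psum.
elim: js g => [|j js IHjs] g /=.
  rewrite /super_psum mulr_suml super_sum; apply: hideal_sum => // i _.
  by rewrite /super_letter /= -mulrA superMl superM_theta inE mulr0; apply: hideal0.
rewrite contract_psum_odd contractsD contractsN contracts_poly.
apply: hidealB => //; apply: hidealMr => //; exact: coinv_contract_coef eqm.
Qed.

End ContractPower.

(** * A basis of each bidegree modulo the power ideal *)

Section SuperBasis.
Variables (K : fieldType) (n r : nat) (z : K).
Hypothesis prim_z : r.-primitive_root z.
Hypothesis char0 : [pchar K] =i pred0.
Local Notation Om := (superspace K n).
Local Notation S := {mpoly K[n]}.
Local Notation powx := (@powx K n r).
Local Notation coinv := (@coinv_ideal K n r).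
Implicit Types (f g : Om) (p q : S) (i j : 'I_n) (A B J : {set 'I_n}).

Let r_gt0 : (0 < r)%N := prim_order_gt0 prim_z.

Variables (d c : nat).

(** Blocks with [#|J| != c] are empty, so all [J] can index one family, of total size the
    coefficient in [coef_staircase_sum]. *)
Definition block_size J : nat := if #|J| == c then ((stair_poly r J)`_d)%R else 0%N.

Lemma block_basis J : exists b : 'I_(block_size J) -> S,
  [/\ forall k, b k \is d.-homog,
      #|J| = c -> forall p, p \is d.-homog -> exists a : _ -> K,
        stair_ideal r J (p - \sum_k a k *: b k) &
      forall a : _ -> K, coinv (colon_poly K r J * \sum_k a k *: b k) -> forall k, a k = 0].
Proof.
rewrite /block_size; case: eqP => cardJ; last first.
  by exists (fun=> 0); split=> // [[]|a _ []].
have [b [hb bP b_free]] := stair_basis prim_z char0 J d.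
by exists b; split=> // _.
Qed.

Definition weight J : nat := (\sum_(i in J) (i : nat))%N.

Section Family.
Variable b : forall J, 'I_(block_size J) -> S.
Arguments b : clear implicits.
Local Notation T := {J : {set 'I_n} & 'I_(block_size J)}.
Local Notation Blk A k := (existT (fun J => 'I_(block_size J)) A k).
Implicit Types (t : T).

Definition super_block t : Om := super_poly (b (tag t) (tagged t)) * super_thetas K (tag t).

Lemma super_block_sum (a : T -> K) J :
  (\sum_t a t *: super_block t) J =
  \sum_k a (Blk J k) *: b J k.
Proof.
rewrite super_sum; transitivity
    (\sum_A \sum_k (a (Blk A k) *: super_block (Blk A k)) J).
  by rewrite (sig_big_dep (fun=> true) (fun _ _ => true)
    (fun A (k : 'I_(block_size A)) => (a (Blk A k) *: super_block (Blk A k)) J)); apply: eq_bigr => -[].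
rewrite (bigD1 J) //= [X in _ + X]big1 ?addr0 => [|A neA].
  by apply: eq_bigr => k _; rewrite superZ superMl ffunE eqxx mulr1.
apply: big1 => k _; rewrite superZ superMl ffunE eq_sym (negPf neA).
by rewrite mulr0 scaler0.
Qed.

(** Induction on the weight of [J]: once the coefficients of smaller weight vanish, contracting by
    [J] leaves [colon_poly K r J] times the component at [J], up to sign, and this lies in
    [coinv]. *)
Lemma super_block_free (a : T -> K) :
    (forall J (a : 'I_(block_size J) -> K),
       coinv (colon_poly K r J * \sum_k a k *: b J k) -> forall k, a k = 0) ->
  power_ideal r (\sum_t a t *: super_block t) -> forall t, a t = 0.
Proof.
move=> b_free If.
suff aJ J k : a (Blk J k) = 0 by case=> J k.
have [m] := ubnP (weight J); elim: m J k => // m IHm J k ltJ.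
pose f := \sum_t a t *: super_block t; have fE := super_block_sum a.
have fP B : f B != 0 -> (\sum_(j <- enum J) (j : nat) <= \sum_(i in B) (i : nat))%N.
  apply: contraR; rewrite -ltnNge big_enum /= => ltB; rewrite fE.
  apply/eqP/big1 => l _; rewrite IHm ?scale0r //.
  exact: leq_trans ltB (ltnSE ltJ).
have [s eqs] := contracts_triangular (@contract_coef_gt K n r) (enum_uniq J) fP.
have := power_ideal_contracts r_gt0 (enum J) If; rewrite eqs.
move/(hidealM (hideal_coinv K n r) ((-1) ^+ s)); rewrite mulrA -expr2 sqrr_sign mul1r.
have -> : [set i in enum J] = J by apply/setP => i; rewrite inE mem_enum.
rewrite fE big_enum /= => /b_free; exact.
Qed.

Inductive super_span : Om -> Prop :=
| super_span_ideal f : power_ideal r f -> super_span f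
| super_spanD f g : super_span f -> super_span g -> super_span (f + g)
| super_span_block (a : K) t : super_span (a *: super_block t).

Lemma super_spanP f : super_span f ->
  exists a : T -> K, power_ideal r (f - \sum_t a t *: super_block t).
Proof.
elim=> [g Ig|g h _ [a Ia] _ [a' Ia']|a t].
- by exists (fun=> 0); rewrite big1 ?subr0 // => t _; rewrite scale0r.
- exists (fun t => a t + a' t).
  have -> : \sum_t (a t + a' t) *: super_block t =
      \sum_t a t *: super_block t + \sum_t a' t *: super_block t.
    by rewrite -big_split; apply: eq_bigr => t _; rewrite scalerDl.
  by rewrite opprD addrACA; apply: power_idealD.
exists (fun t' => if t' == t then a else 0).
rewrite (bigD1 t) //= eqxx [X in _ - (_ + X)]big1 => [|t' net].
  by rewrite addr0 subrr; apply: power_ideal0.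
by rewrite (negPf net) scale0r.
Qed.

Lemma super_spanZ (a : K) f : super_span f -> super_span (a *: f).
Proof.
elim=> [g Ig|g h _ Ig _ Ih|a' t]; first exact/super_span_ideal/power_idealZ.
  by rewrite scalerDr; apply: super_spanD.
by rewrite scalerA; apply: super_span_block.
Qed.

Lemma super_span_sum I (s : seq I) (P : pred I) (F : I -> Om) :
  (forall k, P k -> super_span (F k)) -> super_span (\sum_(k <- s | P k) F k).
Proof.
move=> PF; elim/big_ind: _ => [|f g|] //; last exact: super_spanD.
exact/super_span_ideal/power_ideal0.
Qed.

Lemma super_span0 : super_span 0.
Proof. exact/super_span_ideal/power_ideal0. Qed.

Lemma coinv_power_ideal p g : coinv p -> power_ideal r (super_poly p * g).
Proof.
apply: (@coinv_sub K n r (fun p => power_ideal r (super_poly p * g))) => [|p1 p2 I1 I2|k q].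
- by rewrite super_poly0 mul0r; apply: power_ideal0.
- by rewrite super_polyD mulrDl; apply: power_idealD.
rewrite super_polyM -mulrA -super_psum_even; apply: power_ideal_psum.
by exists k; rewrite addn0.
Qed.

Lemma stair_power_ideal J j : power_ideal r
  (\sum_i super_poly ('X_i ^+ r.-1 * (vpoly K r (below J j)).[powx i]) * super_theta K i : Om).
Proof.
set P := vpoly K r _.
(* Expanding [P] gives letters of total degree [r * m.+1], all valid. *)
have -> : \sum_i super_poly ('X_i ^+ r.-1 * P.[powx i]) * super_theta K i =
    \sum_(m < size P) super_poly (P`_m) * super_psum K n ((r * m + r.-1)%N, true) :> Om.
  transitivity (\sum_i \sum_(m < size P)
    super_poly (P`_m) * super_letter K ((r * m + r.-1)%N, true) i : Om).
    apply: eq_bigr => i _; rewrite horner_coef mulr_sumr super_poly_sum mulr_suml.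
    apply: eq_bigr => m _; rewrite /super_letter /= mulrA -super_polyM.
    by rewrite exprD exprM mulrCA [_ * powx i ^+ m]mulrC.
  by rewrite exchange_big; apply: eq_bigr => m _; rewrite /super_psum mulr_sumr.
apply: power_ideal_sum => m _; apply: power_idealMl.
rewrite -[super_psum _ _ _]mulr1; apply: power_ideal_psum; exists m => /=.
by rewrite mulnS; have := r_gt0; lia.
Qed.

(* Trading an element j of J for a larger one outside J raises the weight, so
   the relation of stair_power_ideal rewrites stair_gen J j * theta_J into terms
   of larger weight. *)
Lemma super_span_theta J p :
    (forall J k, b J k \is d.-homog) ->
    (forall J p, #|J| = c -> p \is d.-homog -> exists a : _ -> K,
       stair_ideal r J (p - \sum_k a k *: b J k)) ->
    #|J| = c -> p \is d.-homog ->
  super_span (super_poly p * super_thetas K J).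
Proof.
move=> hb bP; have [m] := ubnP (weight setT - weight J).
elim: m J p => // m IHm J p ltJ cardJ hp.
have [a Ia] := bP J p cardJ hp.
rewrite -(subrK (\sum_k a k *: b J k) p) super_polyD mulrDl; apply: super_spanD; last first.
  rewrite super_poly_sum mulr_suml; apply: super_span_sum => k _.
  by rewrite super_polyZ -super_scaleAl; apply: (super_span_block _ (Blk J k)).
have: p - \sum_k a k *: b J k \is d.-homog.
  by apply: rpredB => //; apply: rpred_sum => k _; apply: rpredZ; apply: hb.
move: (p - _) Ia.
apply: (iadds_hom_ind (F := fun q => super_span (super_poly q * super_thetas K J))).
- exact: hideal_coinv.
- exact: (homog_stair_gens prim_z).
- by rewrite super_poly0 mul0r; apply: super_span0.
- by move=> p1 p2 S1 S2; rewrite super_polyD mulrDl; apply: super_spanD.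
- by move=> q Iq _; apply/super_span_ideal/coinv_power_ideal.
move=> _ e q /mapP[j Jj ->] he le_ed hq; rewrite mem_enum in Jj.
have [->|nz] := eqVneq (stair_gen K r J j) 0.
  by rewrite mul0r super_poly0 mul0r; apply: super_span0.
have {he} eqe : e = stair_size r J j.
  exact: dhomog_uniq nz he (homog_stair_gen prim_z J j).
pose B := J :\ j; pose P := vpoly K r (below J j).
(* The terms of the relation multiplied by $q\,\theta_{J - j}$; the term at [j] is $g_j q\,\theta_J$
   up to sign. *)
pose F i : Om := super_poly ('X_i ^+ r.-1 * P.[powx i]) * super_theta K i *
  (super_poly q * super_thetas K B).
have FE0 i : F i = super_poly ('X_i ^+ r.-1 * P.[powx i] * q) *
    (super_theta K i * super_thetas K B).
  rewrite /F (super_polyM _ q) -!mulrA [super_theta K i * _]mulrA.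
  by rewrite -[super_theta K i * super_poly q]super_polyC !mulrA.
have FE i : i \notin B -> F i = (-1) ^+ inversions [set i] B *:
    (super_poly ('X_i ^+ r.-1 * P.[powx i] * q) * super_thetas K (i |: B)).
  move=> nBi; rewrite FE0 -[super_theta K i]/(super_thetas K [set i]).
  by rewrite super_thetasM ?disjoints1 // -super_scaleAr.
have sumF : super_span (\sum_i F i).
  rewrite -mulr_suml; apply/super_span_ideal/power_idealMr; exact: stair_power_ideal.
have F_neq i : i != j -> super_span (F i).
  move=> neij; case Bi: (i \in B).
    rewrite FE0; have -> : super_theta K i * super_thetas K B = 0.
      apply/ffunP => C; rewrite superM_theta !ffunE; case: ifP => // _.
      by case: eqP => [eqC|]; rewrite ?mulr0 //; move: Bi; rewrite -eqC setD11.
    by rewrite mulr0; apply: super_span0.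
  rewrite FE ?Bi //; apply: super_spanZ.
  have nJi : i \notin J by move: Bi; rewrite !inE neij /= => ->.
  case: (ltnP i j) => [lt_ij|le_ji].
    (* Here [i] lies in [below J j], so [P] vanishes at $y_i$. *)
    rewrite vpoly_root ?inE ?nJi // mulr0 mul0r super_poly0 mul0r; exact: super_span0.
  have lt_ji : (j < i)%N by rewrite ltn_neqAle le_ji eq_sym andbT.
  have cardB : #|i |: B| = c by rewrite cardsU1 Bi -cardJ (cardsD1 j J) Jj.
  have ltw : (weight J < weight (i |: B))%N.
    by rewrite /weight big_setU1 ?Bi //= (big_setD1 j Jj) ltn_add2r.
  have lew : (weight (i |: B) <= weight setT)%N.
    by rewrite /weight [X in (_ <= X)%N](big_setID (i |: B)) setTI leq_addr.
  apply: IHm => //; first by move: ltJ ltw lew; lia.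
  rewrite -(subnKC le_ed) eqe; apply: dhomogM; last by rewrite -eqe.
  rewrite horner_vpoly; exact: homog_lforms_prod prim_z _ _ _.
have Fj : super_span (F j).
  have -> : F j = \sum_i F i - \sum_(i | i != j) F i.
    by rewrite [X in _ = X - _](bigD1 j) //= addrK.
  rewrite -scaleN1r.
  by apply: super_spanD => //; apply/super_spanZ/super_span_sum.
have nBj : j \notin B by rewrite !inE eqxx.
rewrite (FE j nBj) in Fj; move/(super_spanZ ((-1) ^+ inversions [set j] B)): Fj.
rewrite scalerA -expr2 sqrr_sign scale1r setD1K //.
by rewrite horner_vpoly.
Qed.

Lemma super_span_bihomog f :
    (forall J k, b J k \is d.-homog) ->
    (forall J p, #|J| = c -> p \is d.-homog -> exists a : _ -> K,
       stair_ideal r J (p - \sum_k a k *: b J k)) ->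
  bihomogeneous d c f -> super_span f.
Proof.
move=> hb bP hf; rewrite (super_decomp f); apply: super_span_sum => J _.
rewrite prod_super_theta; have [hJ fJ] := hf J.
have [cardJ|/fJ ->] := eqVneq #|J| c; first exact: super_span_theta.
by rewrite super_poly0 mul0r; apply: super_span0.
Qed.

End Family.
End SuperBasis.

(** * Hilbert series *)

Section StaircaseSum.
Variables (n r : nat).
Hypothesis r_gt0 : (0 < r)%N.
Implicit Types (J : {set 'I_n}) (i j u : 'I_n).

Lemma find_gt_sorted j (s : seq 'I_n) : sorted (fun u v : 'I_n => u < v)%N s ->
  find (fun u : 'I_n => (j < u)%N) s = count (fun u : 'I_n => (u <= j)%N) s.
Proof.
elim: s => //= u s IHs /[dup] /path_sorted ss.
rewrite path_sortedE; last by move=> ? ? ?; apply: ltn_trans.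
case/andP=> /allP lt_us _; case: (ltnP j u) => [lt_ju|le_uj]; last by rewrite IHs.
rewrite add0n; apply/esym/eqP; rewrite -leqn0 leqNgt -has_count; apply/hasPn => v s_v.
by rewrite -ltnNge (ltn_trans lt_ju) // lt_us.
Qed.

Lemma sorted_enum_ord (A : {set 'I_n}) : sorted (fun u v : 'I_n => u < v)%N (enum A).
Proof.
rewrite {1}/enum_mem -enumT; apply: sorted_filter; first by move=> ? ? ?; apply: ltn_trans.
rewrite -[sorted _ _]/(sorted (relpre val ltn) (enum 'I_n)) -sorted_map.
by rewrite val_enum_ord iota_ltn_sorted.
Qed.

(** With [b] elements outside [J] below [j], the staircase value plus one is $(b+1)r - 1 = (r-1) +
    br$. *)
Lemma staircase_size J j : j \in J -> `|(staircase r J j + 1)%R|%N = stair_size r J j.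
Proof.
move=> Jj; rewrite /staircase Jj find_gt_sorted ?sorted_enum_ord // /stair_size.
have -> : count (fun u : 'I_n => (u <= j)%N) (free_seq J) = #|below J j|.
  rewrite -size_filter cardE -filter_predI; congr (size _).
  apply: eq_filter => u; rewrite !inE /=; case Ju: (u \in J); rewrite ?andbF ?andbT //=.
  by rewrite [RHS]ltn_neqAle; case: eqP => // /val_inj equj; rewrite equj Jj in Ju.
by rewrite mulSn; have := r_gt0; lia.
Qed.

Lemma prod_staircase J :
  \prod_(j < n) qnum `|(staircase r J j + 1)%R|%N = stair_poly r J.
Proof.
rewrite (bigID (mem J)) /=; congr (_ * _).
  by apply: eq_bigr => j Jj; rewrite staircase_size.
transitivity (\prod_(j <- free_seq J) qnum ((index j (free_seq J)).+1 * r)).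
  rewrite big_enum; apply: eq_big => [j|j nJj]; first by rewrite inE.
  rewrite /staircase (negPf nJj); congr qnum; have := r_gt0; lia.
have sz : size (free_seq J) = (n - #|J|)%N.
  by rewrite /free_seq -cardE [LHS]cardsCs setCK card_ord.
(* A default element for [nth] is at hand only when the complement of [J] is nonempty. *)
case: (posnP (size (free_seq J))) => [s0|s_gt0].
  by rewrite -sz s0 big_ord0 (size0nil s0) big_nil.
have x0 : 'I_n by case: (free_seq J) s_gt0.
rewrite (big_nth x0) big_mkord sz; apply: eq_bigr => i _.
by rewrite index_uniq ?sz ?enum_uniq // mulnC.
Qed.

Lemma coef_staircase_sum c d : (((staircase_sum n r)`_c)`_d)%R =
  \sum_(J : {set 'I_n}) (if #|J| == c then ((stair_poly r J)`_d)%R else 0%N).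
Proof.
rewrite /staircase_sum coef_sum coef_sum; apply: eq_bigr => J _.
by rewrite coefMC coefXn eq_sym prod_staircase; case: eqP; rewrite ?mul1r ?mul0r ?coef0.
Qed.

End StaircaseSum.

Lemma has_dim_sigma (K : fieldType) (V : lmodType K) (W : V -> Prop) (I : finType)
    (N : I -> nat) (v : {i : I & 'I_(N i)} -> V) :
    (forall t, W (v t)) ->
    (forall a : _ -> K, \sum_t a t *: v t = 0 -> forall t, a t = 0) ->
    (forall u, W u -> exists a : _ -> K, u = \sum_t a t *: v t) ->
  has_dim W (\sum_i N i).
Proof.
move=> Wv v_free v_span.
have cardT : #|{: {i : I & 'I_(N i)}}| = (\sum_i N i)%N.
  rewrite card_tagged sumnE big_map big_enum /=.
  by apply: eq_bigr => i _; rewrite card_ord.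
rewrite -cardT; exists (fun k => v (enum_val k)); split=> [k|a a0 k|u /v_span[a ->]].
- exact: Wv.
- have := v_free (fun t => a (enum_rank t)) _ (enum_val k); rewrite enum_valK; apply.
  rewrite -[RHS]a0 (reindex (@enum_val _ (mem {: {i : I & 'I_(N i)}}))) /=; last first.
    by apply: onW_bij; apply: enum_val_bij.
  by apply: eq_bigr => l _; rewrite enum_valK.
exists (fun k => a (enum_val k)).
by rewrite (reindex (@enum_val _ (mem {: {i : I & 'I_(N i)}}))) //=; apply: onW_bij; apply: enum_val_bij.
Qed.

Section Hilbert.
Variables (K : fieldType) (n r : nat) (z : K).
Hypothesis prim_z : r.-primitive_root z.
Hypothesis char0 : [pchar K] =i pred0.
Local Notation Om := (superspace K n).

Let r_gt0 : (0 < r)%N := prim_order_gt0 prim_z.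

Lemma gen_ideal_power (f : Om) :
  f \in gen_ideal (@positive_invariant K n r) <-> power_ideal r f.
Proof.
split=> [/asboolP[m [a [s [b [Ss ->]]]]]|].
  apply: power_ideal_sum => k _; apply/power_idealMr/power_idealMl.
  exact: (positive_invariant_power prim_z char0).
elim=> [|f1 f2 _ If1 _ If2|l g vl]; [exact: rpred0|exact: rpredD|].
apply: gen_idealMr; apply/asboolP.
exists 1%N, (fun=> 1), (fun=> super_psum K n l), (fun=> 1); split=> [_|].
  exact: (positive_invariant_psum n prim_z vl).
by rewrite big_ord1 mul1r mulr1.
Qed.

Lemma quot_pi0 : quot_pi (@positive_invariant K n r) 0 = 0.
Proof. by apply: (addrI (quot_pi _ 0)); rewrite -quot_piD !addr0. Qed.

Lemma quot_pi_sum (I : finType) (a : I -> K) (v : I -> Om) :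
  \sum_t a t *: (quot_pi (@positive_invariant K n r) (v t) : SR K n r) =
  quot_pi (@positive_invariant K n r) (\sum_t a t *: v t).
Proof.
rewrite (big_morph _ (@quot_piD _ _ _) quot_pi0).
by apply: eq_bigr => t _; rewrite quot_piZ.
Qed.

Lemma SR_Hilb_staircase : SR_Hilb_is K n r (staircase_sum n r).
Proof.
move=> d c; rewrite coef_staircase_sum //.
have /fin_all_exists[b bP] := block_basis prim_z char0 (n := n) d c.
have hb J k : b J k \is d.-homog by have [] := bP J.
have b_free J (a : 'I_(block_size r d c J) -> K) :
    coinv_ideal r (colon_poly K r J * \sum_k a k *: b J k) -> forall k, a k = 0.
  by have [_ _] := bP J; apply.
have b_span (J : {set 'I_n}) (p : {mpoly K[n]}) : #|J| = c -> p \is d.-homog -> exists a : 'I_(block_size r d c J) -> K,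
    stair_ideal r J (p - \sum_k a k *: b J k).
  by move=> cardJ; have [_ + _] := bP J; apply.
apply: (has_dim_sigma (N := block_size r d c)
          (v := fun t => quot_pi _ (super_block b t) : SR K n r)) => [[J k]|a|_ [f hf ->]].
- exists (super_block b (existT _ J k)) => // A; rewrite superMl ffunE /=.
  have cardJ : #|J| = c.
    by move: k; rewrite /block_size; case: eqP => // _ [].
  case: eqP => [->|_]; rewrite ?mulr1 ?mulr0; last by split=> //; apply: dhomog0.
  by split; [apply: hb|rewrite cardJ eqxx].
- rewrite quot_pi_sum => a0.
  apply: (super_block_free prim_z b_free); apply/gen_ideal_power.
  by rewrite -[X in X \in _]subr0; apply/quot_pi_eq; rewrite quot_pi0.
have [a Ia] := super_spanP (super_span_bihomog prim_z hb b_span hf).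
by exists a; rewrite quot_pi_sum; apply/quot_pi_eq/gen_ideal_power.
Qed.

End Hilbert.

(** In characteristic 0 the polynomial $X^m - 1$ is separable, so it has [m] distinct roots, and one
    of them is primitive. *)
Lemma closed_prim_root (F : closedFieldType) m :
  (0 < m)%N -> [pchar F] =i pred0 -> exists w : F, m.-primitive_root w.
Proof.
move=> m_gt0 F0; pose p : {poly F} := 'X^m - 1.
have [rs] := closed_field_poly_normal p; rewrite (monicP (monicXnsubC 1 m_gt0)) scale1r => pE.
have rs_unity : all m.-unity_root rs.
  apply/allP => w rs_w; rewrite unity_rootE.
  have : root p w by rewrite pE root_prod_XsubC.
  by rewrite rootE !hornerE subr_eq0.
have urs : uniq rs.
  rewrite -separable_prod_XsubC -pE; apply: separable_Xn_sub_1.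
  by rewrite ((pcharf0P F).1 F0) -lt0n.
have size_rs : (m <= size rs)%N.
  by rewrite -ltnS -(size_prod_XsubC rs id) -pE size_XnsubC.
have /hasP[w _ prim_w] := has_prim_root m_gt0 rs_unity urs size_rs.
by exists w.
Qed.

Theorem corollary3p22 (R : realType) (n r : nat) (n_gt0 : (0 < n)%N)
    (r_gt0 : (0 < r)%N) :
  SR_Hilb_is R[i] n r (staircase_sum n r).
Proof.
have char0 : [pchar R[i]] =i pred0 := Num.Theory.pchar_num _.
have [z prim_z] := closed_prim_root r_gt0 char0.
exact: SR_Hilb_staircase prim_z char0.
Qed.
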